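(* Let $X$ be a Banach space and let $(T_t)_{t\ge 0}$ be a strongly continuous semigroup of bounded linear operators on $X$ with generator $(L,\mathrm{Dom}(L))$. Let $k:(0,\infty)\times(0,\infty)\to\mathbb{R}$ be an admissible kernel with associated function $\Phi$, and assume that $\Phi$ satisfies the complete monotonicity assumption; let $(A(t))_{t\ge0}$ be the associated nonnegative random variables with distributions $\mathcal{P}_{A(t)}$ (all these terms are defined in the context). Then: (i) For each $t\ge 0$, the operator $\Phi(t,L)$ given by the Bochner integral $$\Phi(t,L)\varphi:=\int_0^\infty T_a\varphi\,\mathcal{P}_{A(t)}(da),\qquad \varphi\in X,$$ is well defined and is a bounded linear operator on $X$. (ii) For each $u_0\in\mathrm{Dom}(L)$, the function $u(t):=\Phi(t,L)u_0$ solves $$u(t)=u_0+\int_0^t k(t,s)\,Lu(s)\,ds,\qquad t>0,$$ and $\lim_{t\searrow 0}u(t)=u_0$ in $X$. (iii) Suppose additionally that $k$ is homogeneous of order $\theta-1$ for some $\theta>0$, i.e. $k(t,ts)=t^{\theta-1}k(1,s)$ for all $t\in(0,\infty)$, $s\in(0,1)$. Then one can choose $A(t):=A\,t^\theta$ in the definition of $\Phi(t,L)$ in (i), where $A$ is a nonnegative random variable such that $$\int_0^\infty e^{-\lambda a}\,\mathcal{P}_A(da)=\Phi(1,-\lambda)\qquad\text{for all }\lambda\in\mathbb{C},\ \mathrm{Re}\,\lambda\ge 0.$$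
   Context: Admissible kernel: a Borel-measurable function $k:(0,\infty)\times(0,\infty)\to\mathbb{R}$ for which there exist $\alpha^*\in[0,1)$ and $\varepsilon>0$ such that for each $T>0$ $$\sup_{0<t\le T} t^{\alpha^*-\frac{1}{1+\varepsilon}}\,\|k(t,\cdot)\|_{L^{1+\varepsilon}((0,t))}<\infty .$$ Associated function $\Phi:[0,\infty)\times\mathbb{C}\to\mathbb{C}$: $\Phi(t,\lambda):=\sum_{n=0}^\infty c_n(t)\lambda^n$, where $c_0(t):=1$ for all $t\ge0$ and, for $n\in\mathbb{N}$, $c_n(t):=\int_0^t k(t,s)c_{n-1}(s)\,ds$ for $t>0$ and $c_n(0):=0$. (For an admissible kernel it is known that these integrals exist and that $\Phi(t,\cdot)$ is entire for each $t\ge 0$.) Complete monotonicity assumption: for every $t\ge0$ the function $\lambda\mapsto\Phi(t,-\lambda)$ is completely monotone on $(0,\infty)$; i.e. for each $t\ge0$ there is a nonnegative random variable $A(t)$ whose distribution $\mathcal{P}_{A(t)}$ satisfies $\int_0^\infty e^{-\lambda a}\,\mathcal{P}_{A(t)}(da)=\Phi(t,-\lambda)$ for all $\lambda\in\mathbb{C}$ with $\mathrm{Re}\,\lambda\ge0$. (In particular $\mathcal{P}_{A(0)}=\delta_0$.) $\mathcal{P}_Y$ denotes the distribution of a random variable $Y$. ''Solves'' means that $u:[0,\infty)\to X$, $u(s)\in\mathrm{Dom}(L)$, and the equation holds as an identity in $X$, the integral being a Bochner integral. *)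

(* Defs.v *)
From HB Require Import structures.
From mathcomp Require Import all_boot all_order all_algebra.
From mathcomp Require Import complex.
From mathcomp Require Import all_classical all_reals all_analysis.
From mathcomp Require Import measurable_realfun.

Set Implicit Arguments.
Unset Strict Implicit.
Unset Printing Implicit Defensive.

Import Order.TTheory GRing.Theory Num.Theory.
Import numFieldNormedType.Exports.

Local Open Scope classical_set_scope.
Local Open Scope ring_scope.

(* A Banach space may be real or complex. *)

Variant scalar_kind := RealScalars | ComplexScalars.

Definition scalars (R : realType) (c : scalar_kind) : numFieldType :=
  match c with RealScalars => R | ComplexScalars => R[i] end.

Definition ofR (R : realType) (c : scalar_kind) : R -> scalars R c :=
  match c return R -> scalars R c with
  | RealScalars => fun r => r
  | ComplexScalars => fun r => (r%:C)%C
  end.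

Definition toR (R : realType) (c : scalar_kind) : scalars R c -> R :=
  match c return scalars R c -> R with
  | RealScalars => fun r => r
  | ComplexScalars => fun z => complex.Re z
  end.

(* The library norm of a complex normed module is valued in R[i], with zero
   imaginary part; this is the same norm with values in R. *)
Definition rnorm (R : realType) (c : scalar_kind)
    (X : normedModType (scalars R c)) (x : X) : R := toR `|x|.

Section bochner.
Context (R : realType) (c : scalar_kind) (X : completeNormedModType (scalars R c)).
Context (d : measure_display) (S : measurableType d).
Variables (mu : {measure set S -> \bar R}) (D : set S).

Definition integrable_simple (s : S -> X) : Prop :=
  [/\ finite_set (range s),
      forall x, measurable (s @^-1` [set x]) &
      forall x, x != 0 -> (mu (D `&` s @^-1` [set x]) < +oo)%E].

(* A value 0 of [s] may be taken on a set of infinite measure, where [fine] is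
   junk; that term vanishes anyway. *)
Definition simple_integral (s : S -> X) : X :=
  \sum_(x \in range s) ofR c (fine (mu (D `&` s @^-1` [set x]))) *: x.

Definition is_bochner_integral (f : S -> X) (v : X) : Prop :=
  exists s : nat -> S -> X,
    [/\ forall n, integrable_simple (s n),
        {ae mu, forall a, D a -> s n a @[n --> \oo] --> f a},
        (\int[mu]_(a in D) (rnorm (f a - s n a))%:E)%E @[n --> \oo] --> 0%E &
        simple_integral (s n) @[n --> \oo] --> v].

Definition bochner_integrable (f : S -> X) : Prop :=
  exists v, is_bochner_integral f v.

(* 0 when [f] is not Bochner integrable. *)
Definition bochner_integral (f : S -> X) : X :=
  xget 0 [set v | is_bochner_integral f v].

End bochner.

Section semigroup.
Context (R : realType) (c : scalar_kind) (X : completeNormedModType (scalars R c)).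

Definition bounded_linear_operator (B : X -> X) : Prop :=
  linear B /\ exists M : R, forall x, rnorm (B x) <= M * rnorm x.

(* Only the times t >= 0 are constrained. *)
Definition strongly_continuous_semigroup (T : R -> X -> X) : Prop :=
  [/\ forall t, 0 <= t -> bounded_linear_operator (T t),
      forall x, T 0 x = x,
      forall s t x, 0 <= s -> 0 <= t -> T (s + t) x = T s (T t x) &
      forall x, {within `[0, +oo[, continuous (fun t => T t x)}].

Definition diff_quotient (T : R -> X -> X) (x : X) (h : R) : X :=
  ofR c h^-1 *: (T h x - x).

Definition gen_dom (T : R -> X -> X) : set X :=
  [set x | cvg (diff_quotient T x h @[h --> 0^'+])].

(* Meaningful on [gen_dom T] only. *)
Definition gen (T : R -> X -> X) (x : X) : X :=
  lim (diff_quotient T x h @[h --> 0^'+]).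

(* Phi(t, L) x, as a function of the distribution mu of A(t). *)
Definition Phi_op (T : R -> X -> X) (mu : {measure set R -> \bar R}) (x : X) : X :=
  bochner_integral mu `[0, +oo[ (fun a => T a x).

End semigroup.

Section kernel.
Context (R : realType).

Definition admissible (k : R -> R -> R) : Prop :=
  measurable_fun [set p : R * R | 0 < p.1 /\ 0 < p.2] (fun p : R * R => k p.1 p.2) /\
  exists alpha eps : R, [/\ 0 <= alpha < 1, 0 < eps &
    forall T : R, 0 < T ->
      (ereal_sup [set (t `^ (alpha - (1 + eps)^-1))%R%:E *
           'N[lebesgue_measure]_((1 + eps)%:E)[EFin \o (k t \_ `]0%R, t[)]
         | t in `]0%R, T]%classic] < +oo)%E].

Fixpoint Phi_coef (k : R -> R -> R) (n : nat) (t : R) : R :=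
  match n with
  | 0 => 1
  | n'.+1 => if 0 < t then
      \int[lebesgue_measure]_(s in `]0, t[) (k t s * Phi_coef k n' s)
    else 0
  end.

Definition Phi (k : R -> R -> R) (t : R) (lambda : R[i]) : R[i] :=
  limn (series (fun n => ((Phi_coef k n t)%:C)%C * lambda ^+ n : R[i]^o)).

Definition homogeneous (k : R -> R -> R) (r : R) : Prop :=
  forall t s, 0 < t -> 0 < s < 1 -> k t (t * s) = t `^ r * k 1 s.

Definition cexp (z : R[i]) : R[i] :=
  ((expR (complex.Re z) * cos (complex.Im z)) +i*
   (expR (complex.Re z) * sin (complex.Im z)))%C.

Definition laplace (mu : {measure set R -> \bar R}) (lambda : R[i]) : R[i] :=
  ((\int[mu]_(a in `[0, +oo[) complex.Re (cexp (- lambda * (a%:C)%C))) +i*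
   (\int[mu]_(a in `[0, +oo[) complex.Im (cexp (- lambda * (a%:C)%C))))%C.

(* The complete monotonicity of Phi(t, - .), in the form: the random variable
   [A] is nonnegative and Phi(t, - .) is the Laplace transform of its law. *)
Definition represents (k : R -> R -> R) (t : R) (d : measure_display)
    (Omega : measurableType d) (P : probability Omega R) (A : {RV P >-> R}) : Prop :=
  (forall w, 0 <= A w) /\
  forall lambda : R[i], 0 <= complex.Re lambda ->
    laplace (distribution P A) lambda = Phi k t (- lambda).

End kernel.

(* Main.v *)
(** The orbit a |-> T_a x is approximated, uniformly with respect to the weight
    e^(W a), by finite sums of exponentials e^(l a) with vector coefficients:
    in the variable z = e^(-a) these are the Bernstein polynomials of
    z^W T_(- ln z) x.  For a sum of exponentials every integral in the theorem
    is a scalar one, and the equation reduces to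
    l * int_0^t k(t,s) Phi(s,l) ds = Phi(t,l) - 1 for real l, which is read off
    the power series.  The error terms are controlled by the exponential moments
    of A(t): the Laplace transform near 0 determines the moments n! c_n(t) of
    A(t), by Fatou's lemma applied to the Taylor remainders of e^(-x), and
    summing them gives E e^(l A(t)) = Phi(t,l) for every real l.  Uniqueness of
    the law is never needed: the approximation shows that Phi(t,L) depends only
    on the Laplace transform. *)
Require Import Defs.
From HB Require Import structures.
From mathcomp Require Import all_boot all_order all_algebra.
From mathcomp Require Import complex.
From mathcomp Require Import all_classical all_reals all_analysis.
From mathcomp Require Import measurable_realfun.
From mathcomp Require Import ring lra.

Set Implicit Arguments.
Unset Strict Implicit.
Unset Printing Implicit Defensive.

Import Order.TTheory GRing.Theory Num.Theory.
Import numFieldNormedType.Exports.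

Local Open Scope classical_set_scope.
Local Open Scope ring_scope.

(** * The real norm of a Banach space over either scalar field *)

(** The obstacle in (ii) is an iterated vector integral together with the passage of the unbounded
    [L] through it. It is met by approximating the orbit of [L u0] rather than that of [u0]: the
    same exponential sum, integrated termwise in [a], approximates [T_a u0 - u0] by a mean value
    inequality. Both sides of the equation are then close to one finite sum with coefficients
    [(Phi(t,l) - 1) / l]. This division forces all exponents to be nonzero. They have the form
    [W - j] with [j] natural, so [W] is a half-integer: the growth rate, rounded up to a natural
    number, plus 3/2. Integrability comes along the way: a function approximated by step functions,
    with errors that have measurable majorants of small integral, is Bochner integrable, and its
    integral is the limit of the finite sums. On the kernel side the main input is that [c_n(t)]
    decays faster than any geometric sequence, uniformly for [t] in a bounded interval. *)

Section scalars.
Context (R : realType) (c : scalar_kind).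
Implicit Types r s : R.

Lemma ofR0 : ofR c (0 : R) = 0. Proof. by case: c. Qed.
Lemma ofR1 : ofR c (1 : R) = 1. Proof. by case: c. Qed.
Lemma ofRD r s : ofR c (r + s) = ofR c r + ofR c s.
Proof. by case: c => //=; rewrite rmorphD. Qed.
Lemma ofRM r s : ofR c (r * s) = ofR c r * ofR c s.
Proof. by case: c => //=; rewrite rmorphM. Qed.
Lemma ofRN r : ofR c (- r) = - ofR c r.
Proof. by case: c => //=; rewrite rmorphN. Qed.
Lemma ofRB r s : ofR c (r - s) = ofR c r - ofR c s.
Proof. by rewrite ofRD ofRN. Qed.
Lemma ofR_nat n : ofR c (n%:R : R) = n%:R.
Proof. by case: c => //=; rewrite rmorph_nat. Qed.
Lemma ofRK : cancel (@ofR R c) (@toR R c). Proof. by case: c. Qed.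
Lemma normr_ofR r : `|ofR c r| = ofR c `|r|.
Proof. by case: c => //=; rewrite normc_def /= expr0n /= addr0 sqrtr_sqr. Qed.
Lemma ler_ofR r s : (ofR c r <= ofR c s) = (r <= s).
Proof. by case: c => //=; rewrite lecR. Qed.
Lemma ltr_ofR r s : (ofR c r < ofR c s) = (r < s).
Proof. by case: c => //=; rewrite ltcR. Qed.
Lemma ge0_ofRK (z : scalars R c) : 0 <= z -> ofR c (toR z) = z.
Proof. by case: c z => //= z; rewrite lecE /= => /andP[/eqP]; case: z => a b /= ->. Qed.

End scalars.

Section rnorm.
Context (R : realType) (c : scalar_kind) (X : completeNormedModType (scalars R c)).
Implicit Types (x y : X) (r : R).

Lemma ofR_rnorm x : ofR c (rnorm x) = `|x|.
Proof. by rewrite ge0_ofRK. Qed.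

Lemma rnorm_ge0 x : 0 <= rnorm x.
Proof. by rewrite -(ler_ofR c) ofR_rnorm ofR0. Qed.

Lemma rnorm0 : rnorm (0 : X) = 0.
Proof. by rewrite /rnorm normr0 -(ofR0 R c) ofRK. Qed.

Lemma rnorm_eq0 x : (rnorm x == 0) = (x == 0).
Proof.
apply/eqP/eqP => [h|->]; last exact: rnorm0.
by apply/eqP; rewrite -normr_eq0 -ofR_rnorm h ofR0.
Qed.

Lemma rnormD x y : rnorm (x + y) <= rnorm x + rnorm y.
Proof. by rewrite -(ler_ofR c) ofRD !ofR_rnorm ler_normD. Qed.

Lemma rnormN x : rnorm (- x) = rnorm x.
Proof. by rewrite /rnorm normrN. Qed.

Lemma rnormBC x y : rnorm (x - y) = rnorm (y - x).
Proof. by rewrite -rnormN opprB. Qed.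

Lemma rnormB_split z x y : rnorm (x - y) <= rnorm (x - z) + rnorm (z - y).
Proof. by rewrite (le_trans _ (rnormD _ _))// addrA subrK. Qed.

Lemma rnormZ (a : scalars R c) x : rnorm (a *: x) = toR `|a| * rnorm x.
Proof.
apply: (can_inj (@ofRK R c)).
by rewrite ofR_rnorm normrZ ofRM ofR_rnorm ge0_ofRK.
Qed.

Lemma rnormZr r x : rnorm (ofR c r *: x) = `|r| * rnorm x.
Proof. by rewrite rnormZ normr_ofR ofRK. Qed.

Lemma rnorm_sum I (s : seq I) (F : I -> X) :
  rnorm (\sum_(i <- s) F i) <= \sum_(i <- s) rnorm (F i).
Proof.
elim: s => [|i s ih]; first by rewrite !big_nil rnorm0.
by rewrite !big_cons (le_trans (rnormD _ _))// lerD2l.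
Qed.

Lemma cvg_rnormP (I : Type) (F : set_system I) (FF : Filter F) (f : I -> X) x :
  f @ F --> x <-> forall e : R, 0 < e -> \forall i \near F, rnorm (x - f i) < e.
Proof.
split=> [/cvgrPdist_lt h e e0|h].
  have : 0 < ofR c e by rewrite -(ofR0 R c) ltr_ofR.
  by move=> /h; apply: filterS => i; rewrite -ofR_rnorm ltr_ofR.
apply/cvgrPdist_lt => e e0.
have ee : ofR c (toR e) = e by rewrite ge0_ofRK// ltW.
have : 0 < toR e by rewrite -(ltr_ofR c) ee ofR0.
by move=> /h; apply: filterS => i hi; rewrite -ofR_rnorm -ee ltr_ofR.
Qed.

Lemma cvg_rnorm0 (I : Type) (F : set_system I) (FF : Filter F) (f : I -> X) x :
  f @ F --> x <-> rnorm (x - f i) @[i --> F] --> (0 : R).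
Proof.
rewrite cvg_rnormP; split => [h|/cvgrPdist_lt h e e0].
  apply/cvgrPdist_lt => e e0; have := h e e0; apply: filterS => i.
  by rewrite sub0r normrN ger0_norm ?rnorm_ge0.
have := h e e0; apply: filterS => i.
by rewrite sub0r normrN ger0_norm ?rnorm_ge0.
Qed.

Lemma cauchy_rnorm (f : nat -> X) :
  (forall e : R, 0 < e -> exists N, forall n m, (N <= n)%N -> (N <= m)%N ->
     rnorm (f n - f m) < e) ->
  exists x, f @ \oo --> x.
Proof.
move=> h; exists (lim (f @ \oo)); apply: cauchy_cvg; apply/cauchy_ballP => e e0; near_simpl.
have ee : ofR c (toR e) = e by rewrite ge0_ofRK// ltW.
have : 0 < toR e by rewrite -(ltr_ofR c) ee ofR0.
move=> /h [N hN]; exists ([set n | (N <= n)%N], [set n | (N <= n)%N]).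
  by split; exists N.
move=> [n m] [/= hn hm].
by rewrite -ball_normE /ball_/= -ofR_rnorm -ee ltr_ofR; exact: hN.
Qed.

Lemma rnorm_lim_le (f : nat -> X) x (e : R) :
  f @ \oo --> x -> (\forall n \near \oo, rnorm (f n) <= e) -> rnorm x <= e.
Proof.
move=> /(cvg_rnormP eventually_filter) h he.
apply/ler_addgt0Pr => d d0.
have [n [/ltW hn hen]] : exists n, rnorm (x - f n) < d /\ rnorm (f n) <= e.
  have : \forall n \near \oo, rnorm (x - f n) < d /\ rnorm (f n) <= e.
    by apply: filterI => //; exact: h.
  by move=> [N _ hN]; exists N; exact: (hN N (leqnn N)).
rewrite -[x](subrK (f n)) (le_trans (rnormD _ _))// addrC.
by rewrite lerD.
Qed.

Lemma rnorm_eq (x y : X) :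
  (forall e : R, 0 < e -> rnorm (x - y) <= e) -> x = y.
Proof.
move=> h; apply/eqP; rewrite -subr_eq0 -rnorm_eq0 eq_le rnorm_ge0 andbT.
by apply/ler_addgt0Pr => e e0; rewrite add0r h.
Qed.

End rnorm.

(** * Step functions and the Bochner integral *)

Section lower_integral.
Context d (S : measurableType d) (R : realType) (mu : {measure set S -> \bar R}).
Local Open Scope ereal_scope.

(** The integral of a nonnegative function is a supremum over the simple functions below it, hence
    monotone for arbitrary functions. It is applied to error norms whose measurability is
    unknown. *)
Lemma ge0_le_lower_integral (D : set S) (f g : S -> \bar R) :
  (forall x, D x -> 0 <= f x) -> (forall x, D x -> f x <= g x) ->
  \int[mu]_(x in D) f x <= \int[mu]_(x in D) g x.
Proof.
move=> f0 fg; rewrite !ge0_integralE//; last first.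
  by move=> x Dx; rewrite (le_trans (f0 x Dx))// fg.
apply: le_ereal_sup => _ [h hf <-]; exists h => // x.
rewrite (le_trans (hf x))// /patch; case: ifPn => //.
by rewrite inE => /fg.
Qed.

End lower_integral.

Section step.
Context (R : realType) (c : scalar_kind) (X : completeNormedModType (scalars R c)).
Context (d : measure_display) (S : measurableType d).
Variables (mu : {measure set S -> \bar R}) (D : set S).
Hypothesis mD : measurable D.
Hypothesis muD : (mu D < +oo)%E.

(** A finite measurable partition, encoded by the map that sends a point to its cell; pairing two
    such maps gives the common refinement. *)
Definition label (J : finType) (phi : S -> J) :=
  forall j, measurable (phi @^-1` [set j]).

Definition weight (J : finType) (phi : S -> J) (j : J) : R :=
  fine (mu (D `&` phi @^-1` [set j])).

Lemma mu_fin (A : set S) : measurable A -> mu (D `&` A) \is a fin_num.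
Proof.
move=> mA; rewrite ge0_fin_numE// (le_lt_trans _ muD)// le_measure ?inE//.
exact: measurableI.
Qed.

Lemma weightE (J : finType) (phi : S -> J) j : label phi ->
  (weight phi j)%:E = mu (D `&` phi @^-1` [set j]).
Proof. by move=> mphi; rewrite /weight fineK// mu_fin. Qed.

Lemma weight_ge0 (J : finType) (phi : S -> J) j : 0 <= weight phi j.
Proof. by rewrite fine_ge0. Qed.

Lemma label_preimage (J : finType) (phi : S -> J) (A : set J) : label phi ->
  measurable (phi @^-1` A).
Proof.
move=> mphi.
rewrite (_ : _ @^-1` _ = \bigcup_(j in A) (phi @^-1` [set j])).
  by apply: fin_bigcup_measurable => // j _; exact: mphi.
apply/seteqP; split => a.
  by move=> Aa; exists (phi a).
by move=> [k Ak] /= ka; move: Ak; rewrite -ka.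
Qed.

Lemma label_pair (J K : finType) (phi : S -> J) (psi : S -> K) :
  label phi -> label psi -> label (fun a => (phi a, psi a)).
Proof.
move=> mphi mpsi [j k].
rewrite (_ : _ @^-1` _ = phi @^-1` [set j] `&` psi @^-1` [set k]).
  exact: measurableI.
apply/seteqP; split => a.
  by move=> [/= -> ->].
by move=> [/= ja ka]; rewrite /preimage /= ja ka.
Qed.

Lemma mu_label (J : finType) (phi : S -> J) (P : pred J) : label phi ->
  mu (D `&` phi @^-1` [set j | P j]) = (\sum_(j | P j) (weight phi j)%:E)%E.
Proof.
move=> mphi.
rewrite (_ : _ `&` _ = \bigcup_(j in [set j | P j]) (D `&` phi @^-1` [set j])).
  rewrite measure_fin_bigcup//; last 3 first.
  - exact: finite_finset.
  - by move=> j k _ _ [a [[_ /= <-] [_ /= <-]]].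
  - by move=> j _; exact: measurableI.
  rewrite (fsbigE [seq j <- enum J | P j]).
  - rewrite big_filter_cond big_enum_cond/=.
    apply: eq_big => [j|j _]; last by rewrite weightE.
    by rewrite mem_setE andbb.
  - by rewrite filter_uniq// enum_uniq.
  - by move=> j /=; rewrite mem_filter => /andP[].
  - by move=> j /= Pj; rewrite mem_filter Pj mem_enum.
apply/seteqP; split => [a [Da /= Pa]|a [j /= Pj [Da ja]]]; first by exists (phi a).
by split=> //=; rewrite ja.
Qed.

Lemma integrable_indic_in (A : set S) : measurable A ->
  mu.-integrable D (fun a => (\1_A a)%:E).
Proof.
move=> mA; apply/integrableP; split.
  by apply/measurable_EFinP; exact: measurable_indic.
under eq_integral do rewrite gee0_abs ?lee_fin//.
by rewrite integral_indic// setIC -ge0_fin_numE// mu_fin.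
Qed.

Lemma step_integral (J : finType) (phi : S -> J) (w : J -> R) : label phi ->
  mu.-integrable D (EFin \o (w \o phi)) /\
  (\int[mu]_(a in D) (w (phi a))%:E = (\sum_j w j * weight phi j)%:E)%E.
Proof.
move=> mphi.
have E a : (w (phi a))%:E = (\sum_(j <- enum J) ((w j)%:E * (\1_(phi @^-1` [set j]) a)%:E))%E.
  rewrite big_enum/= (bigD1 (phi a))//= big1 ?adde0 ?indicE ?mem_set// ?mule1//.
  move=> j ja; rewrite indicE memNset ?mule0// => /= /esym/eqP.
  by apply/negP.
have I j : mu.-integrable D (fun a => (w j)%:E * (\1_(phi @^-1` [set j]) a)%:E)%E.
  apply: integrableZl => //.
  exact: integrable_indic_in.
split.
  rewrite (_ : EFin \o _ = fun a => (\sum_(j <- enum J) ((w j)%:E * (\1_(phi @^-1` [set j]) a)%:E))%E).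
    by apply: integrable_sum.
  by apply/funext => a /=; rewrite E.
under eq_integral do rewrite E.
rewrite integral_sum//.
rewrite big_enum /= -sumEFin; apply: eq_bigr => j _.
rewrite integralZl//; last exact: integrable_indic_in.
by rewrite integral_indic// setIC EFinM weightE.
Qed.

(** The map [h] may repeat values: the sum over distinct values groups the labels with equal [h],
    and additivity of the measure splits each group. Values that are not attained have an empty
    preimage. *)
Lemma simple_integral_step (J : finType) (phi : S -> J) (h : J -> X) :
  label phi ->
  simple_integral mu D (h \o phi) = \sum_j ofR c (weight phi j) *: h j.
Proof.
move=> mphi; rewrite /simple_integral.
rewrite (fsbig_fwiden (undup [seq h j | j <- enum J]))/=; last 3 first.
- by move=> x [a _ <-] /=; rewrite mem_undup map_f// mem_enum.
- exact: undup_uniq.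
- move=> x [_ nx] /=; rewrite (_ : _ `&` _ = set0) ?measure0 ?ofR0 ?scale0r//.
  by apply/seteqP; split => // a [_ /= xa]; apply: nx; exists a.
have E x : ofR c (fine (mu (D `&` (h \o phi) @^-1` [set x]))) *: x =
    \sum_(j | h j == x) ofR c (weight phi j) *: h j.
  have -> : (h \o phi) @^-1` [set x] = phi @^-1` [set j | h j == x].
    by apply/seteqP; split => a /= /eqP.
  rewrite mu_label// sumEFin/= (big_morph (@ofR R c) (@ofRD R c) (ofR0 R c)).
  by rewrite scaler_suml; apply: eq_bigr => j /eqP ->.
under eq_bigr do rewrite E.
rewrite (exchange_big_dep xpredT)//=; apply: eq_bigr => j _.
rewrite -big_filter (_ : [seq _ <- _ | _] = [:: h j]) ?big_seq1//.
rewrite (@eq_filter _ _ (pred1 (h j))) ?filter_pred1_uniq ?undup_uniq//.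
  by rewrite mem_undup map_f// mem_enum.
by move=> x /=; rewrite eq_sym.
Qed.

Lemma integrable_simple_step (J : finType) (phi : S -> J) (h : J -> X) :
  label phi -> integrable_simple mu D (h \o phi).
Proof.
move=> mphi; split.
- by rewrite -(image_comp phi h); exact: (finite_image h (@finite_finset J _)).
- by move=> x; rewrite comp_preimage; exact: label_preimage.
- move=> x _; rewrite -ge0_fin_numE//; apply: mu_fin.
  by rewrite comp_preimage; exact: label_preimage.
Qed.

Lemma stepW (Y : choiceType) (y0 : Y) (s : S -> Y) : finite_set (range s) ->
  (forall x, measurable (s @^-1` [set x])) ->
  exists (J : finType) (phi : S -> J) (h : J -> Y), label phi /\ s = h \o phi.
Proof.
move=> /finite_seqP[l El] ms.
(* The cell of [a] is the first position of [s a] in [l]. Neither the extra index [size l] nor the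
   position of a repeated entry is ever attained; their cells are empty. *)
have sl a : (index (s a) l < (size l).+1)%N by rewrite ltnS index_size.
exists 'I_(size l).+1, (fun a => Ordinal (sl a)), (fun j : 'I_(size l).+1 => nth y0 l j).
have E : s = (fun j : 'I_(size l).+1 => nth y0 l j) \o (fun a => Ordinal (sl a)).
  apply/funext => a /=; rewrite nth_index//.
  by have : [set` l] (s a) by rewrite -El; exists a.
split=> // j.
have [jl|jl] := ltnP j (size l).
  have [ij|ij] := eqVneq (index (nth y0 l j) l) j.
    rewrite (_ : _ @^-1` _ = s @^-1` [set nth y0 l j])//.
    apply/seteqP; split => a /=.
      by move=> <- /=; rewrite nth_index//; have : [set` l] (s a) by rewrite -El; exists a.
    by move=> h; apply: val_inj => /=; rewrite h ij.
  rewrite (_ : _ @^-1` _ = set0)//.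
  apply/seteqP; split => a //= ja; move/negP: ij; apply; rewrite -ja /=.
  by rewrite nth_index//; have : [set` l] (s a) by rewrite -El; exists a.
rewrite (_ : _ @^-1` _ = set0)//.
apply/seteqP; split => a //= ja.
have : [set` l] (s a) by rewrite -El; exists a.
by rewrite /= -index_mem; move: jl; rewrite -ja /= leqNgt => /negbTE ->.
Qed.

End step.

(** * Functions approximable by step functions up to measurable error bounds *)

Section tame.
Context (R : realType) (c : scalar_kind) (X : completeNormedModType (scalars R c)).
Context (d : measure_display) (S : measurableType d).
Variables (mu : {measure set S -> \bar R}) (D : set S).
Hypothesis mD : measurable D.
Hypothesis muD : (mu D < +oo)%E.

Definition step_sum (J : finType) (phi : S -> J) (h : J -> X) : X :=
  \sum_j ofR c (weight mu D phi j) *: h j.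

Lemma weight_fst (J K : finType) (phi : S -> J) (psi : S -> K) j :
  label phi -> label psi ->
  weight mu D phi j = \sum_k weight mu D (fun a => (phi a, psi a)) (j, k).
Proof.
move=> mphi mpsi; apply: EFin_inj; rewrite weightE// -sumEFin.
rewrite (_ : phi @^-1` _ = (fun a => (phi a, psi a)) @^-1` [set p | p.1 == j]); last first.
  by apply/seteqP; split => a /= => [->|/eqP].
rewrite mu_label//; last exact: label_pair.
rewrite (reindex_onto (fun k => (j, k)) snd)/=; last by move=> [j' k] /= /eqP ->.
by apply: eq_bigl => k; rewrite !eqxx.
Qed.

Lemma weight_snd (J K : finType) (phi : S -> J) (psi : S -> K) k :
  label phi -> label psi ->
  weight mu D psi k = \sum_j weight mu D (fun a => (phi a, psi a)) (j, k).
Proof.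
move=> mphi mpsi; apply: EFin_inj; rewrite weightE// -sumEFin.
rewrite (_ : psi @^-1` _ = (fun a => (phi a, psi a)) @^-1` [set p | p.2 == k]); last first.
  by apply/seteqP; split => a /= => [->|/eqP].
rewrite mu_label//; last exact: label_pair.
rewrite (reindex_onto (fun j => (j, k)) fst)/=; last by move=> [j k'] /= /eqP ->.
by apply: eq_bigl => j; rewrite !eqxx.
Qed.

Lemma step_sum_pair (J K : finType) (phi : S -> J) (psi : S -> K) h g :
  label phi -> label psi ->
  step_sum (fun a => (phi a, psi a)) (fun p => h p.1 + g p.2) =
  step_sum phi h + step_sum psi g.
Proof.
move=> mphi mpsi; rewrite /step_sum.
under eq_bigr do rewrite scalerDr.
rewrite big_split/=; congr (_ + _).
- under [RHS]eq_bigr do rewrite (weight_fst _ mphi mpsi)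
    (big_morph (@ofR R c) (@ofRD R c) (ofR0 R c)) scaler_suml.
  by rewrite pair_big/=; apply: eq_bigr => -[].
- under [RHS]eq_bigr do rewrite (weight_snd _ mphi mpsi)
    (big_morph (@ofR R c) (@ofRD R c) (ofR0 R c)) scaler_suml.
  by rewrite exchange_big/= pair_big/=; apply: eq_bigr => -[].
Qed.

Lemma step_sum_opp (J : finType) (phi : S -> J) (h : J -> X) :
  step_sum phi (fun j => - h j) = - step_sum phi h.
Proof. by rewrite -sumrN; apply: eq_bigr => j _; rewrite scalerN. Qed.

Lemma rnorm_step_sum (J : finType) (phi : S -> J) (h : J -> X) :
  rnorm (step_sum phi h) <= \sum_j rnorm (h j) * weight mu D phi j.
Proof.
rewrite (le_trans (rnorm_sum _ _))// ler_sum// => j _.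
by rewrite rnormZr ger0_norm ?weight_ge0// mulrC.
Qed.

Lemma step_dist (J K : finType) (phi : S -> J) (psi : S -> K) h g (q u : S -> R) :
  label phi -> label psi -> measurable_fun D u ->
  (forall a, D a -> 0 <= q a) -> (forall a, D a -> 0 <= u a) ->
  (forall a, D a -> rnorm (h (phi a) - g (psi a)) <= q a + u a) ->
  ((rnorm (step_sum phi h - step_sum psi g))%:E <=
   \int[mu]_(a in D) (q a)%:E + \int[mu]_(a in D) (u a)%:E)%E.
Proof.
move=> mphi mpsi mu_ q0 u0 hg.
pose chi a := (phi a, psi a).
pose w p := rnorm (h p.1 - g p.2).
have mchi : label chi by exact: label_pair.
have [iw Ew] := step_integral mD muD w mchi.
rewrite -step_sum_opp -step_sum_pair//.
apply: (@le_trans _ _ (\int[mu]_(a in D) (w (chi a))%:E)%E).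
  by rewrite Ew lee_fin; exact: rnorm_step_sum.
have mw : measurable_fun D (w \o chi) by apply/measurable_EFinP; case/integrableP: iw.
(* The integral is not additive on the possibly nonmeasurable [q]. The measurable function [r] lies
   below [q] and satisfies [w (chi a) <= r a + u a], so additivity is used on [r + u] and
   monotonicity takes [r] to [q]. *)
pose r a := Num.max (w (chi a) - u a) 0.
have mr : measurable_fun D r.
  apply: measurable_maxr => //; exact: measurable_funB.
apply: (@le_trans _ _ (\int[mu]_(a in D) ((r a)%:E + (u a)%:E))%E).
  apply: ge0_le_lower_integral => a Da; rewrite ?lee_fin ?rnorm_ge0//.
  by rewrite -lerBlDr le_max lexx.
rewrite ge0_integralD//; last 3 first.
- by move=> a Da; rewrite lee_fin le_max lexx orbT.
- exact/measurable_EFinP.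
- exact/measurable_EFinP.
apply: leeD => //; apply: ge0_le_lower_integral => a Da; rewrite lee_fin.
  by rewrite le_max lexx orbT.
by rewrite ge_max q0// andbT lerBlDr hg.
Qed.

(* The errors have measurable majorants, so that [f] itself is not required to
   be measurable. *)
Definition tame (f : S -> X) (v : X) : Prop := forall e : R, 0 < e ->
  exists (J : finType) (phi : S -> J) (h : J -> X) (w : S -> R),
  [/\ label phi, measurable_fun D w,
      forall a, D a -> rnorm (f a - h (phi a)) <= w a,
      (\int[mu]_(a in D) (w a)%:E <= e%:E)%E &
      rnorm (v - step_sum phi h) <= e].

(** The error [f - s n] of an arbitrary Bochner approximation may be nonmeasurable and plays the
    part of [q] in [step_dist]; the other errors have measurable majorants. The case [p = f] gives
    uniqueness of the integral, the general case all later error estimates. *)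
Lemma bochner_tame_dist f v p v' (e : S -> R) (E : R) :
  is_bochner_integral mu D f v -> tame p v' -> measurable_fun D e ->
  (forall a, D a -> rnorm (f a - p a) <= e a) ->
  (\int[mu]_(a in D) (e a)%:E <= E%:E)%E ->
  rnorm (v - v') <= E.
Proof.
move=> [s [ss _ scv sv]] tp me fp eE.
apply/ler_addgt0Pr => _ /posnumP[x].
(* Four errors of size [y]: each of the two step functions is off once as a function and once
   through its integral. *)
pose y := x%:num / 4; have y0 : 0 < y by rewrite divr_gt0.
have [K [psi [g [w [mpsi mw gw wy gv]]]]] := tp y y0.
have : \forall n \near \oo, (\int[mu]_(a in D) (rnorm (f a - s n a))%:E <= y%:E)%E.
  move/fine_cvgP : scv => [fin /cvgrPdist_lt/(_ _ y0)].
  apply: filterS2 fin => n fin.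
  rewrite sub0r normrN => /(le_lt_trans (ler_norm _))/ltW.
  by rewrite -lee_fin fineK.
have : \forall n \near \oo, rnorm (v - simple_integral mu D (s n)) < y.
  by move/(cvg_rnormP eventually_filter): sv => /(_ _ y0).
move=> [N1 _ h1] [N2 _ h2].
pose n := maxn N1 N2.
have {h1} := h1 n (leq_maxl _ _); have {h2} := h2 n (leq_maxr _ _) => /=.
have [r1 r2 _] := ss n.
have [J [phi [h [mphi ->]]]] := @stepW _ _ X (0 : X) (s n) r1 r2.
rewrite simple_integral_step// => fs vs.
rewrite (le_trans (rnormB_split (step_sum phi h) _ _))//.
have D1 : rnorm (step_sum phi h - step_sum psi g) <= y + (E + y).
  rewrite -lee_fin; apply: (le_trans (step_dist (q := fun a => rnorm (f a - h (phi a)))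
    (u := fun a => e a + w a) mphi mpsi _ _ _ _)).
  - exact: measurable_funD.
  - by move=> a _; exact: rnorm_ge0.
  - by move=> a Da; rewrite addr_ge0// (le_trans (rnorm_ge0 _) (fp a Da), le_trans (rnorm_ge0 _) (gw a Da)).
  - move=> a Da; rewrite (le_trans (rnormB_split (f a) _ _))// rnormBC lerD2l.
    rewrite (le_trans (rnormB_split (p a) _ _))// lerD ?fp//.
    exact: gw.
  - rewrite EFinD leeD//.
    under eq_integral do rewrite EFinD.
    rewrite ge0_integralD//; last 4 first.
    + by move=> a Da; rewrite lee_fin (le_trans (rnorm_ge0 _) (fp a Da)).
    + exact/measurable_EFinP.
    + by move=> a Da; rewrite lee_fin (le_trans (rnorm_ge0 _) (gw a Da)).
    + exact/measurable_EFinP.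
    by rewrite EFinD leeD.
have := rnormB_split (step_sum psi g) (step_sum phi h) v'.
move: vs gv D1; rewrite (rnormBC v'); rewrite -/(step_sum phi h).
have -> : x%:num = 4 * y by rewrite mulrC divfK.
lra.
Qed.

Lemma tame_simple f v (e : R) : tame f v -> 0 < e ->
  exists p : (S -> X) * (S -> R),
  [/\ integrable_simple mu D p.1, measurable_fun D p.2,
      forall a, D a -> rnorm (f a - p.1 a) <= p.2 a,
      (\int[mu]_(a in D) (p.2 a)%:E <= e%:E)%E &
      rnorm (v - simple_integral mu D p.1) <= e].
Proof.
move=> tf e0; have [J [phi [h [w [mphi mw fw we ve]]]]] := tf e e0.
exists (h \o phi, w); split => //=; first exact: integrable_simple_step.
by rewrite simple_integral_step.
Qed.

(** The integrals are summable, so the sum of the [w n] has a finite integral and is finite almost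
    everywhere; its tails, which dominate its terms, then tend to 0. *)
Lemma ae_cvg0_integral_summable (w : nat -> S -> R) (e : R) :
  (forall n, measurable_fun D (w n)) -> (forall n a, D a -> 0 <= w n a) ->
  (forall n, (\int[mu]_(a in D) (w n a)%:E <= (e / (2 ^ n.+1)%:R)%:E)%E) ->
  0 <= e ->
  {ae mu, forall a, D a -> w n a @[n --> \oo] --> 0}.
Proof.
move=> mw w0 we e0.
have mW n : measurable_fun D (EFin \o w n) by exact/measurable_EFinP.
have iW : mu.-integrable D (fun a => \sum_(n <oo) (w n a)%:E)%E.
  apply/integrableP; split.
    apply: (@ge0_emeasurable_sum _ _ _ D (fun n a => (w n a)%:E) xpredT) => //.
    by move=> n a Da _; rewrite lee_fin w0.
    by move=> n _; exact: mW.
  rewrite (eq_integral (fun a => \sum_(n <oo) (w n a)%:E)%E); last first.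
    move=> a; rewrite inE => Da.
    by rewrite gee0_abs//; apply: nneseries_ge0 => n _ _; rewrite lee_fin w0.
  rewrite integral_nneseries//.
  apply: (@le_lt_trans _ _ e%:E); last exact: ltry.
  apply: le_trans (epsilon_trick0 xpredT e0).
  apply: lee_nneseries => // n _ _.
  by apply: integral_ge0 => a Da; rewrite lee_fin w0.
apply: filterS (integrable_ae mD iW) => a aW Da.
have Wfin : (\sum_(n <oo) (w n a)%:E < +oo)%E.
  by rewrite -ge0_fin_numE ?aW//; apply: nneseries_ge0 => n _ _; rewrite lee_fin w0.
have := nneseries_tail_cvg Wfin (fun n _ => w0 n a Da).
move=> /fine_cvgP[fin] /cvgrPdist_lt h.
apply/cvgrPdist_lt => x x0.
move: (h x x0); apply: filterS2 fin => n fin.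
rewrite !sub0r !normrN; apply: le_lt_trans.
rewrite ger0_norm ?w0// (le_trans _ (ler_norm _))// -lee_fin fineK//.
rewrite (nneseries_split _ 1)//; last by move=> k _; rewrite lee_fin w0.
rewrite addn1 big_nat1 leeDl// nneseries_ge0// => k _ _.
by rewrite lee_fin w0.
Qed.

Lemma tame_bochner f v : tame f v -> is_bochner_integral mu D f v.
Proof.
move=> tf.
(* Errors that merely tend to 0 would give convergence in mean only; summable ones also give
   convergence almost everywhere. *)
pose e n : R := 1 / (2 ^ n.+1)%:R.
have e0 n : 0 < e n by rewrite divr_gt0// ltr0n expn_gt0.
have ecv : e n @[n --> \oo] --> 0.
  apply: (@squeeze_cvgr _ _ _ _ (cst 0) (@harmonic R)); [|exact: cvg_cst|exact: cvg_harmonic].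
  near=> n; rewrite ltW//= /e div1r lef_pV2 ?posrE ?ltr0n ?expn_gt0//.
  by rewrite ler_nat; apply: ltnW; exact: ltn_expl.
have /choice[p hp] := fun n => tame_simple tf (e0 n).
exists (fun n => (p n).1).
have w0 n a : D a -> 0 <= (p n).2 a.
  by move=> Da; have [_ _ h _ _] := hp n; exact: le_trans (rnorm_ge0 _) (h a Da).
split.
- by move=> n; have [] := hp n.
- have : {ae mu, forall a, D a -> (p n).2 a @[n --> \oo] --> 0}.
    by apply: (@ae_cvg0_integral_summable (fun n => (p n).2) 1) => // n; have [] := hp n.
  apply: filterS => a h Da; apply/cvg_rnorm0.
  + apply: (@squeeze_cvgr _ _ _ _ (cst 0) (fun n => (p n).2 a)); [|exact: cvg_cst|exact: h].
    by near=> n; rewrite rnorm_ge0/=; have [_ _ -> //] := hp n; exact: h.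
- apply: (@squeeze_cvge _ _ _ _ (cst 0%E) _ (fun n => (e n)%:E)).
  + near=> n; rewrite integral_ge0/=; last by move=> a _; rewrite lee_fin rnorm_ge0.
    have [_ _ h hi _] := hp n; apply: le_trans hi.
    by apply: ge0_le_lower_integral => a Da; rewrite lee_fin ?rnorm_ge0// h.
  + exact: cvg_cst.
  + by apply: cvg_EFin => //; exact: nearW.
- apply/cvg_rnorm0; apply: (@squeeze_cvgr _ _ _ _ (cst 0) e) => //; last exact: cvg_cst.
  by near=> n; rewrite rnorm_ge0/=; have [_ _ _ _] := hp n.
Unshelve. all: by end_near. Qed.

End tame.

Section linear_operators.
Context (R : realType) (c : scalar_kind) (X : completeNormedModType (scalars R c)).
Variable B : X -> X.
Hypothesis lB : linear B.

Lemma linop0 : B 0 = 0.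
Proof. by have := lB (-1) 0 0; rewrite scaler0 addr0 scaleN1r addNr. Qed.

Lemma linopD x y : B (x + y) = B x + B y.
Proof. by rewrite -[x in LHS]scale1r lB scale1r. Qed.

Lemma linopZ a x : B (a *: x) = a *: B x.
Proof. by rewrite -[_ *: _ in LHS]addr0 lB linop0 addr0. Qed.

Lemma linopN x : B (- x) = - B x.
Proof. by rewrite -scaleN1r linopZ scaleN1r. Qed.

Lemma linopB x y : B (x - y) = B x - B y.
Proof. by rewrite linopD linopN. Qed.

End linear_operators.

Lemma bounded_linear_bound (R : realType) (c : scalar_kind)
    (X : completeNormedModType (scalars R c)) (B : X -> X) :
  bounded_linear_operator B -> exists2 M : R, 0 < M & forall x, rnorm (B x) <= M * rnorm x.
Proof.
move=> [_ [M hM]]; exists (`|M| + 1) => [|x]; first by rewrite ltr_wpDl.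
rewrite (le_trans (hM x))// ler_wpM2r ?rnorm_ge0//.
by rewrite (le_trans (ler_norm M))// lerDl.
Qed.

Section tame_theory.
Import HBSimple.
Context (R : realType) (c : scalar_kind) (X : completeNormedModType (scalars R c)).
Context (d : measure_display) (S : measurableType d).
Variables (mu : {measure set S -> \bar R}) (D : set S).
Hypothesis mD : measurable D.
Hypothesis muD : (mu D < +oo)%E.

Local Notation tame := (@tame R c X d S mu D).

Lemma tame_dist f v p v' (e : S -> R) (E : R) :
  tame f v -> tame p v' -> measurable_fun D e ->
  (forall a, D a -> rnorm (f a - p a) <= e a) ->
  (\int[mu]_(a in D) (e a)%:E <= E%:E)%E -> rnorm (v - v') <= E.
Proof. by move=> /(tame_bochner mD muD); exact: bochner_tame_dist. Qed.

Lemma bochner_unique f v v' : is_bochner_integral mu D f v -> tame f v' -> v = v'.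
Proof.
move=> bf tf; apply: rnorm_eq => e e0.
apply: (bochner_tame_dist mD muD bf tf (e := cst 0)) => //.
- by move=> a _; rewrite subrr rnorm0.
- by rewrite integral0 lee_fin ltW.
Qed.

Lemma tame_integrable f v : tame f v -> bochner_integrable mu D f.
Proof. by move=> /(tame_bochner mD muD); exists v. Qed.

Lemma tame_integral f v : tame f v -> bochner_integral mu D f = v.
Proof.
move=> tf; apply: xget_unique; first exact: tame_bochner.
by move=> w bw; exact: bochner_unique bw tf.
Qed.

Lemma eq_tame f g v : (forall a, D a -> f a = g a) -> tame f v -> tame g v.
Proof.
move=> fg tf e e0; have [J [phi [h [w [? ? fw ? ?]]]]] := tf e e0.
exists J, phi, h, w; split => // a Da; rewrite -fg//; exact: fw.
Qed.

Lemma tame_op B f v : bounded_linear_operator B -> tame f v -> tame (B \o f) (B v).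
Proof.
move=> bB tf e e0; have [M M0 hM] := bounded_linear_bound bB; have [lB _] := bB.
have [J [phi [h [w [mphi mw fw we ve]]]]] := tf (e / M) (divr_gt0 e0 M0).
exists J, phi, (B \o h), (fun a => M * w a); split => //=.
- exact: measurable_funM.
- by move=> a Da; rewrite -linopB// (le_trans (hM _))// ler_pM2l// fw.
- under eq_integral do rewrite EFinM.
  rewrite ge0_integralZl_EFin//; last 3 first.
  + by move=> a Da; rewrite lee_fin (le_trans (rnorm_ge0 _) (fw a Da)).
  + exact/measurable_EFinP.
  + exact: ltW.
  by rewrite -lee_pdivlMl// -EFinM mulrC.
- have -> : step_sum mu D phi (B \o h) = B (step_sum mu D phi h).
    rewrite /step_sum (big_morph _ (linopD lB) (linop0 lB)).
    by apply: eq_bigr => j _; rewrite linopZ.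
  by rewrite -linopB// (le_trans (hM _))// mulrC -ler_pdivlMr.
Qed.

Lemma tameD f g v w : tame f v -> tame g w -> tame (fun a => f a + g a) (v + w).
Proof.
move=> tf tg e e0; have e20 : 0 < e / 2 by rewrite divr_gt0.
have [J [phi [h [u [mphi m_u fu ue ve]]]]] := tf _ e20.
have [K [psi [k [z [mpsi m_z gz ze we]]]]] := tg _ e20.
exists (J * K)%type, (fun a => (phi a, psi a)), (fun p => h p.1 + k p.2),
  (fun a => u a + z a); split => /=.
- exact: label_pair.
- exact: measurable_funD.
- by move=> a Da; rewrite opprD addrACA (le_trans (rnormD _ _))// lerD ?fu ?gz.
- under eq_integral do rewrite EFinD.
  rewrite ge0_integralD//; last 4 first.
  + by move=> a Da; rewrite lee_fin (le_trans (rnorm_ge0 _) (fu a Da)).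
  + exact/measurable_EFinP.
  + by move=> a Da; rewrite lee_fin (le_trans (rnorm_ge0 _) (gz a Da)).
  + exact/measurable_EFinP.
  by rewrite [e]splitr EFinD leeD.
- rewrite step_sum_pair// opprD addrACA (le_trans (rnormD _ _))//.
  by rewrite [e]splitr lerD.
Qed.

Lemma tame0 : tame (cst 0) 0.
Proof.
move=> e e0; exists unit, (fun=> tt), (fun=> 0), (cst 0); split => //=.
- case; rewrite (_ : _ @^-1` _ = setT)//; exact/seteqP.
- by move=> a _; rewrite subrr rnorm0.
- by rewrite integral0 lee_fin ltW.
- by rewrite /step_sum big1 ?subrr ?rnorm0 ?(ltW e0)// => j _; rewrite scaler0.
Qed.

Lemma tame_scale (g : S -> R) (x : X) : mu.-integrable D (EFin \o g) ->
  tame (fun a => ofR c (g a) *: x) (ofR c (\int[mu]_(a in D) g a) *: x).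
Proof.
move=> ig e e0.
have x1 : 0 < rnorm x + 1 by rewrite ltr_wpDl ?rnorm_ge0.
pose y := e / (rnorm x + 1); have y0 : 0 < y by rewrite divr_gt0.
have [g_ [ig_ _ cg]] := approximation_sfun_integrable mD ig.
have [n hn] : exists n, (\int[mu]_(z in D) `|(g z)%:E - (g_ n z)%:E| <= y%:E)%E.
  move/fine_cvgP : cg => [fin /cvgrPdist_lt/(_ _ y0)] H.
  have [N _ h] := filterI fin H; exists N; have [fN] := h N (leqnn N).
  rewrite sub0r normrN => /(le_lt_trans (ler_norm _))/ltW.
  by rewrite -lee_fin fineK.
have [J [phi [r [mphi Er]]]] : exists (J : finType) (phi : S -> J) (r : J -> R),
    label phi /\ (g_ n : S -> R) = r \o phi.
  apply: (stepW (0 : R)); first exact: fimfunP.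
  by move=> z; exact: measurable_funPTI.
have rE a : g_ n a = r (phi a) by rewrite Er.
have mg : measurable_fun D g by apply/measurable_EFinP; case/integrableP: ig.
have mw : measurable_fun D (fun a => `|g a - g_ n a|).
  apply: measurableT_comp => //; apply: measurable_funB => //.
  exact: measurable_funTS.
have hn' : (\int[mu]_(a in D) `|g a - g_ n a|%:E <= y%:E)%E by [].
have yx : y * rnorm x <= e.
  by rewrite /y -mulrA ger_pMr// mulrC ler_pdivrMr// mul1r lerDl.
exists J, phi, (fun j => ofR c (r j) *: x), (fun a => `|g a - g_ n a| * rnorm x); split => //=.
- exact: measurable_funM.
- by move=> a Da; rewrite -scalerBl -ofRB rnormZr rE.
- under eq_integral do rewrite EFinM muleC.
  rewrite ge0_integralZl_EFin ?rnorm_ge0//; last exact/measurable_EFinP.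
  apply: (@le_trans _ _ ((rnorm x)%:E * y%:E)%E).
    by rewrite lee_wpmul2l// lee_fin rnorm_ge0.
  by rewrite -EFinM lee_fin mulrC.
- rewrite /step_sum; under eq_bigr do rewrite scalerA -ofRM mulrC.
  rewrite -scaler_suml -(big_morph (@ofR R c) (@ofRD R c) (ofR0 R c)).
  rewrite -scalerBl -ofRB rnormZr.
  have [ir Eir] := step_integral mD muD r mphi.
  have -> : \sum_j r j * weight mu D phi j = \int[mu]_(a in D) (g_ n a).
    by rewrite /Rintegral; under eq_integral do rewrite rE; rewrite Eir.
  rewrite -RintegralB//.
  rewrite (le_trans _ yx)// ler_wpM2r ?rnorm_ge0//.
  apply: (le_trans (le_normr_Rintegral _ _)) => //.
    exact: (integrableB mD ig (ig_ n)).
  rewrite /Rintegral -lee_fin fineK//.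
  by rewrite ge0_fin_numE ?integral_ge0// (le_lt_trans hn')// ltry.
Qed.

(** By [tame_dist] the integrals of the approximants form a Cauchy sequence, and completeness yields
    the value. The limit [f] borrows the step functions of a good approximant, with [r * h] added to
    their error bound. *)
Lemma tame_lim f (h : S -> R) (H : R) : measurable_fun D h ->
  (forall a, D a -> 0 <= h a) -> (\int[mu]_(a in D) (h a)%:E <= H%:E)%E ->
  (forall e : R, 0 < e -> exists p v, tame p v /\
     forall a, D a -> rnorm (f a - p a) <= e * h a) ->
  exists v, tame f v.
Proof.
move=> mh h0 hH H_.
have H0 : 0 <= H.
  by rewrite -lee_fin (le_trans _ hH)// integral_ge0// => a Da; rewrite lee_fin h0.
have intZ (r : R) : 0 <= r -> (\int[mu]_(a in D) (r * h a)%:E <= (r * H)%:E)%E.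
  move=> r0; under eq_integral do rewrite EFinM.
  by rewrite ge0_integralZl_EFin//; [rewrite EFinM lee_wpmul2l|exact/measurable_EFinP].
have n0 n : 0 < (n.+1%:R^-1 : R) by rewrite invr_gt0.
have /choice[pv hpv] : forall n, exists pv : (S -> X) * X, tame pv.1 pv.2 /\
    forall a, D a -> rnorm (f a - pv.1 a) <= n.+1%:R^-1 * h a.
  by move=> n; have [p [v hp]] := H_ _ (n0 n); exists (p, v).
have vv n m : rnorm ((pv n).2 - (pv m).2) <= (n.+1%:R^-1 + m.+1%:R^-1) * H.
  have [tn hn] := hpv n; have [tm hm] := hpv m.
  apply: (tame_dist tn tm (e := fun a => (n.+1%:R^-1 + m.+1%:R^-1) * h a)).
  - exact: measurable_funM.
  - move=> a Da; rewrite (le_trans (rnormB_split (f a) _ _))// mulrDl lerD//.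
      by rewrite rnormBC hn.
    exact: hm.
  - by apply: intZ; rewrite addr_ge0// ltW.
have small (e : R) : 0 < e -> exists N, forall n, (N <= n)%N -> n.+1%:R^-1 * (H + 1) < e.
  move=> e0.
  have H1 : 0 < H + 1 by rewrite ltr_wpDl.
  have [N _ hN] := near_infty_natSinv_lt (PosNum (divr_gt0 e0 H1)).
  by exists N => n /hN /=; rewrite ltr_pdivlMr.
have [v cv] : exists v : X, (fun n => (pv n).2) @ \oo --> v.
  apply: (@cauchy_rnorm _ _ _ (fun n => (pv n).2)) => e e0.
  have [N hN] := small (e / 2) (divr_gt0 e0 (ltr0Sn _ _)).
  exists N => n m /hN hn /hN hm; rewrite (le_lt_trans (vv n m))//.
  move: (n0 n) (n0 m) hn hm; move: (n.+1%:R^-1) (m.+1%:R^-1) => a b; nra.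
exists v => e e0.
have [N hN] := small (e / 4) (divr_gt0 e0 (ltr0Sn _ _)).
have := hN N (leqnn N); set r := N.+1%:R^-1 => hr.
have r0 : 0 < r by exact: n0.
have [tN pN] := hpv N.
have vN : rnorm (v - (pv N).2) <= e / 2.
  apply: (rnorm_lim_le (f := fun n => (pv n).2 - (pv N).2)).
    by apply: cvgB => //; exact: cvg_cst.
  near=> n; rewrite (le_trans (vv _ _))//.
  have : n.+1%:R^-1 * (H + 1) < e / 4 by apply: hN; near: n; exact: nbhs_infty_ge.
  rewrite -/r; move: (n0 n) hr r0; move: (n.+1%:R^-1) => a; nra.
have [J [phi [k [w [mphi mw fw we ve]]]]] := tN (e / 4) (divr_gt0 e0 (ltr0Sn _ _)).
exists J, phi, k, (fun a => r * h a + w a); split => //.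
- by apply: measurable_funD => //; exact: measurable_funM.
- move=> a Da; rewrite (le_trans (rnormB_split ((pv N).1 a) _ _))// lerD ?fw//.
  exact: pN.
- under eq_integral do rewrite EFinD.
  rewrite ge0_integralD//; last 4 first.
  + by move=> a Da; rewrite lee_fin mulr_ge0// ?h0// ltW.
  + by apply/measurable_EFinP; exact: measurable_funM.
  + by move=> a Da; rewrite lee_fin (le_trans (rnorm_ge0 _) (fw a Da)).
  + exact/measurable_EFinP.
  apply: (@le_trans _ _ ((r * H)%:E + (e / 4)%:E)%E).
    by rewrite leeD// intZ// ltW.
  by rewrite -EFinD lee_fin; nra.
- have := rnormB_split (pv N).2 v (step_sum mu D phi k).
  lra.
Unshelve. all: by end_near. Qed.

Lemma tame_sum (I : Type) (s : seq I) (F : I -> S -> X) (v : I -> X) :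
  (forall i, tame (F i) (v i)) ->
  tame (fun a => \sum_(i <- s) F i a) (\sum_(i <- s) v i).
Proof.
move=> tF; elim: s => [|i s ih].
  by rewrite big_nil; apply: eq_tame tame0 => a _; rewrite big_nil.
rewrite big_cons; apply: eq_tame (tameD (tF i) ih) => a _.
by rewrite big_cons.
Qed.

End tame_theory.

(** * Uniform boundedness and the growth of a semigroup *)

Section uniform_boundedness.
Context (R : realType) (c : scalar_kind) (X : completeNormedModType (scalars R c)).

(** A centre moves by at most half a radius while the radius at least halves, so the closed balls
    are nested and the centres converge to a common point. *)
Lemma nested_balls (x : nat -> X) (r : nat -> R) :
  (forall n, 0 < r n) -> (forall n, rnorm (x n.+1 - x n) <= r n / 2) ->
  (forall n, r n.+1 <= r n / 2) ->
  exists y, forall n, rnorm (y - x n) <= r n.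
Proof.
move=> r0 xx rr.
have nest n k : rnorm (x (k + n)%N - x n) <= r n.
  elim: k n => [n|k ih n]; first by rewrite add0n subrr rnorm0 ltW.
  rewrite addSnnS (le_trans (rnormB_split (x n.+1) _ _))//.
  by have := ih n.+1; have := rr n; have := xx n; lra.
have rn n : r n <= r 0%N * 2^-1 ^+ n.
  elim: n => [|n ih]; first by rewrite expr0 mulr1.
  by rewrite exprS; have := rr n; lra.
have small (e : R) : 0 < e -> exists N, r N < e.
  move=> e0; have : r 0%N * 2^-1 ^+ n @[n --> \oo] --> r 0%N * 0.
    apply: cvgMr; apply: cvg_expr; rewrite ger0_norm//; lra.
  rewrite mulr0 => /cvgrPdist_lt/(_ _ e0)[N _ /(_ N (leqnn N))].
  rewrite sub0r normrN => h; exists N.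
  by rewrite (le_lt_trans (rn N))// (le_lt_trans (ler_norm _)).
have [y cy] : exists y : X, x @ \oo --> y.
  apply: cauchy_rnorm => e e0.
  have [N hN] := small (e / 2) (divr_gt0 e0 (ltr0Sn _ _)).
  exists N => n m Nn Nm; rewrite (le_lt_trans (rnormB_split (x N) _ _))//.
  have := nest N (n - N)%N; have := nest N (m - N)%N; rewrite !subnK// rnormBC.
  lra.
exists y => n; apply: (rnorm_lim_le (f := fun m => x m - x n)).
  by apply: cvgB => //; exact: cvg_cst.
near=> m; have nm : (n <= m)%N by near: m; exact: nbhs_infty_ge.
by rewrite -(subnK nm).
Unshelve. all: by end_near. Qed.

(* Sokal's argument: T (x + y) and T (x - y) cannot both be small when T y is
   large, so a small ball can be moved to a place where some T_i is large. *)
Lemma uniform_boundedness (I : Type) (F : I -> X -> X) :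
  (forall i, bounded_linear_operator (F i)) ->
  (forall x, exists C : R, forall i, rnorm (F i x) <= C) ->
  exists M : R, forall i x, rnorm (F i x) <= M * rnorm x.
Proof.
move=> bF pF; apply: contrapT => unb.
have big (M : R) : exists i x, M * rnorm x < rnorm (F i x).
  apply: contrapT => h; apply: unb; exists M => i x.
  by rewrite leNgt; apply/negP => ?; apply: h; exists i, x.
have step (p : nat * {posnum R} * X) : exists q : {posnum R} * X,
    [/\ rnorm (q.2 - p.2) <= p.1.2%:num / 2, q.1%:num <= p.1.2%:num / 2 &
      exists i, forall z, rnorm (z - q.2) <= q.1%:num -> p.1.1%:R <= rnorm (F i z)].
  move: p => [[n r] x] /=.
  have r20 : 0 < r%:num / 2 by rewrite divr_gt0.
  (* The threshold is chosen so that [F i] exceeds [n + 1] at the multiple [z] of [y] with norm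
     [r / 2]. *)
  have [i [y hy]] := big (n.+1%:R / (r%:num / 2)).
  have [lF _] := bF i; have [M M0 hM] := bounded_linear_bound (bF i).
  have y0 : 0 < rnorm y.
    rewrite lt_neqAle rnorm_ge0 andbT eq_sym rnorm_eq0; apply/eqP => y0.
    by move: hy; rewrite y0 (linop0 lF) rnorm0 mulr0 ltxx.
  pose z := ofR c (r%:num / 2 / rnorm y) *: y.
  have nz : rnorm z = r%:num / 2.
    by rewrite rnormZr ger0_norm ?divr_ge0 ?ltW// divfK ?gt_eqF.
  have Fz : n.+1%:R < rnorm (F i z).
    rewrite (linopZ lF) rnormZr ger0_norm ?divr_ge0 ?(ltW r20) ?(ltW y0)//.
    move: hy; rewrite mulrAC ltr_pdivrMr// => hy.
    by rewrite [ltRHS]mulrC mulrA ltr_pdivlMr.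
  have [w [wx Fw]] : exists w, rnorm (w - x) <= r%:num / 2 /\ n.+1%:R < rnorm (F i w).
    have [h|h] := ltP n.+1%:R (rnorm (F i (x + z))).
      by exists (x + z); rewrite addrAC subrr add0r nz.
    exists (x - z); rewrite addrAC subrr add0r rnormN nz; split=> //.
    have := rnormBC (F i (x + z)) (F i (x - z)).
    have : rnorm (F i (x + z) - F i (x - z)) = 2 * rnorm (F i z).
      rewrite -(linopB lF) opprB addrC addrA subrK -mulr2n -scaler_nat (linopZ lF) rnormZ.
      by rewrite normr_nat -ofR_nat ofRK.
    have := rnormD (F i (x + z)) (- F i (x - z)); rewrite rnormN.
    lra.
  (* On a ball of radius [M^-1] the value of [F i] moves by at most 1, so the bound [n + 1] at the
     centre leaves [n] on the whole ball. *)
  have m0 : 0 < Num.min (r%:num / 2) M^-1 by rewrite lt_min r20 invr_gt0.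
  exists (PosNum m0, w) => /=; split => //; first by rewrite ge_min lexx.
  exists i => u; rewrite le_min => /andP[_ uw].
  have : rnorm (F i w - F i u) <= 1.
    rewrite -(linopB lF) (le_trans (hM _))// rnormBC.
    by rewrite -ler_pdivlMl// mulr1.
  have := rnormB_split (F i u) (F i w) 0; rewrite !subr0.
  by move: Fw; rewrite -natr1; lra.
have /choice[nxt hnxt] := step.
pose q := fix q n := if n is n'.+1 then nxt (n', (q n').1, (q n').2) else (PosNum ltr01, 0 : X).
have [y hy] : exists y, forall n, rnorm (y - (q n).2) <= (q n).1%:num.
  apply: (@nested_balls (fun n => (q n).2) (fun n => (q n).1%:num)) => n //.
    by have [] := hnxt (n, (q n).1, (q n).2).
  by have [] := hnxt (n, (q n).1, (q n).2).
have [C hC] := pF y.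
pose n := (Num.truncn C).+1.
have [_ _ [i /(_ y (hy n.+1))/=]] := hnxt (n, (q n).1, (q n).2).
apply/negP; rewrite -ltNge (le_lt_trans (hC i))//.
by rewrite /n truncnS_gt.
Qed.

End uniform_boundedness.

(** * Exponential growth bound of a strongly continuous semigroup *)

Section growth.
Context (R : realType) (c : scalar_kind) (X : completeNormedModType (scalars R c)).
Variable T : R -> X -> X.
Hypothesis hT : strongly_continuous_semigroup T.

Lemma semigroup_cvg0 x (e : R) : 0 < e ->
  exists2 h : R, 0 < h & forall t, 0 <= t -> t < h -> rnorm (T t x - x) < e.
Proof.
move=> e0; have [_ T0 _ cT] := hT.
have /subspace_continuousP/(_ 0) := cT x.
rewrite /from_subspace T0 => /(_ _)/(cvg_rnormP _) h.
have : \forall t \near within `[0, +oo[%classic (nbhs (0 : R)), rnorm (x - T t x) < e.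
  by apply: h => //=; rewrite in_itv/= lexx.
rewrite /within/= => /nbhs_ballP[r /= r0 hr].
exists r => // t t0 tr; rewrite rnormBC; apply: hr.
  by rewrite /ball/= sub0r normrN ger0_norm.
by rewrite /= in_itv/= t0.
Qed.

(** Otherwise there are times below [1 / (n + 1)] at which the operator norm exceeds [n]. Each orbit
    is bounded along these times, by continuity at 0 up to finitely many of them, which contradicts
    uniform boundedness. *)
Lemma semigroup_bounded0 : exists2 h : R, 0 < h &
  exists M : R, forall t x, 0 <= t -> t < h -> rnorm (T t x) <= M * rnorm x.
Proof.
have [bT T0 _ _] := hT.
apply: contrapT => H.
have big n : exists t : R, [/\ 0 <= t, t < n.+1%:R^-1 & exists x, n%:R * rnorm x < rnorm (T t x)].
  apply: contrapT => h; apply: H; exists n.+1%:R^-1; first by rewrite invr_gt0.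
  exists n%:R => t x t0 tn; rewrite leNgt; apply/negP => ?.
  by apply: h; exists t; split => //; exists x.
have /choice[t ht] := big.
have [M hM] : exists M : R, forall n x, rnorm (T (t n) x) <= M * rnorm x.
  apply: uniform_boundedness => [n|x]; first by apply: bT; have [] := ht n.
  have [h h0 hx] := semigroup_cvg0 x ltr01.
  have [N _ hN] := near_infty_natSinv_lt (PosNum h0).
  exists (\sum_(i < N) rnorm (T (t i) x) + (rnorm x + 1)) => n.
  have [nN|Nn] := ltnP n N.
    rewrite (bigD1 (Ordinal nN))//= -addrA lerDl addr_ge0//.
      by apply: sumr_ge0 => i _; exact: rnorm_ge0.
    by rewrite addr_ge0 ?rnorm_ge0.
  have [t0 tn _] := ht n.
  have := hx (t n) t0 (lt_trans tn (hN n Nn)).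
  have := rnormD (T (t n) x - x) x; rewrite subrK.
  have : 0 <= \sum_(i < N) rnorm (T (t i) x) by apply: sumr_ge0 => i _; exact: rnorm_ge0.
  lra.
pose n := (Num.truncn M).+1.
have [_ _ [x]] := ht n; apply/negP; rewrite -leNgt (le_trans (hM n x))//.
by rewrite ler_wpM2r ?rnorm_ge0// ltW// /n truncnS_gt.
Qed.

(** The rate is a natural number so that adding 3/2 to it later avoids every natural number. *)
Lemma semigroup_growth : exists M : R, 1 <= M /\
  exists w : nat, forall t x, 0 <= t -> rnorm (T t x) <= M * expR (w%:R * t) * rnorm x.
Proof.
have [bT T0 TD _] := hT.
have [h h0 [M' hM']] := semigroup_bounded0.
pose M := `|M'| + 1; have M1 : 1 <= M by rewrite lerDr.
have hM t x : 0 <= t -> t < h -> rnorm (T t x) <= M * rnorm x.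
  move=> t0 th; rewrite (le_trans (hM' _ _ t0 th))// ler_wpM2r ?rnorm_ge0//.
  by rewrite (le_trans (ler_norm _))// lerDl.
have M0 : 0 < M by exact: lt_le_trans M1.
pose g := h / 2.
have g0 : 0 < g by rewrite divr_gt0.
have gh : g < h by rewrite /g; lra.
(* Each further stretch of time of length [g] costs a factor [M], which [e^(w g)] pays for. *)
pose w := (Num.truncn (ln M / g)).+1.
have hw : M <= expR (w%:R * g).
  rewrite -ler_ln ?posrE ?expR_gt0// expRK -ler_pdivrMr// ltW//.
  by rewrite truncnS_gt.
exists M; split => //; exists w.
have key n t x : 0 <= t -> t < n.+1%:R * g -> rnorm (T t x) <= M * expR (w%:R * t) * rnorm x.
  elim: n t => [t t0|n ih t t0 tn].
    rewrite mul1r => tg; rewrite (le_trans (hM _ _ t0 (lt_trans tg gh)))//.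
    rewrite ler_wpM2r ?rnorm_ge0// ler_peMr// ?(ltW M0)//.
    by rewrite -expR0 ler_expR mulr_ge0.
  have [tg|gt] := ltP t g.
    rewrite (le_trans (hM _ _ t0 (lt_trans tg gh)))//.
    rewrite ler_wpM2r ?rnorm_ge0// ler_peMr// ?(ltW M0)//.
    by rewrite -expR0 ler_expR mulr_ge0.
  rewrite -{1}(subrK g t) addrC TD ?(ltW g0) ?subr_ge0//.
  rewrite (le_trans (hM _ _ (ltW g0) gh))// -!mulrA ler_pM2l//.
  have tg0 : 0 <= t - g by rewrite subr_ge0.
  have tgn : t - g < n.+1%:R * g by move: tn; rewrite -natr1 mulrDl mul1r; lra.
  rewrite (le_trans (ih _ tg0 tgn))// ler_wpM2r ?rnorm_ge0//.
  have -> : w%:R * t = w%:R * g + w%:R * (t - g) by rewrite -mulrDr addrC subrK.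
  by rewrite expRD ler_wpM2r ?expR_ge0.
move=> t x t0; apply: (key (Num.truncn (t / g)) t x t0).
by rewrite -ltr_pdivrMr// truncnS_gt.
Qed.

End growth.

(** * Approximation of orbits by sums of exponentials *)

Section bernstein.
Context (R : realType).

(* [sbern N f z] is the expectation of [f] at a binomial variable with
   parameters N and z, computed by conditioning on the first trial. *)
Fixpoint sbern (N : nat) (f : nat -> R) (z : R) : R :=
  if N is n.+1 then (1 - z) * sbern n f z + z * sbern n (f \o succn) z else f 0%N.

Lemma ler_sbern N f g z : 0 <= z <= 1 -> (forall j, (j <= N)%N -> f j <= g j) ->
  sbern N f z <= sbern N g z.
Proof.
move=> /andP[z0 z1]; elim: N f g => [|n ih] f g fg /=; first exact: fg.
rewrite lerD// ler_wpM2l ?subr_ge0// ih// => j jn; apply: fg => //.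
exact: leqW.
Qed.

(** Variance plus squared bias of a binomial variable about [x]. The point [x] is kept general
    because conditioning on the first trial shifts it by 1. *)
Lemma sbern_sqr N a b x z :
  sbern N (fun j => a + b * (j%:R - x) ^+ 2) z =
  a + b * (N%:R * z * (1 - z) + (N%:R * z - x) ^+ 2).
Proof.
elim: N x => [|n ih] x /=; first by ring.
rewrite (_ : _ \o succn = fun j => a + b * (j%:R - (x - 1)) ^+ 2); last first.
  by apply/funext => j /=; rewrite -natr1; ring.
by rewrite !ih -natr1; ring.
Qed.

Context (c : scalar_kind) (X : completeNormedModType (scalars R c)).

Fixpoint bern (N : nat) (f : nat -> X) (z : R) : X :=
  if N is n.+1 then ofR c (1 - z) *: bern n f z + ofR c z *: bern n (f \o succn) z
  else f 0%N.

Lemma rnorm_bern N f z x : 0 <= z <= 1 ->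
  rnorm (x - bern N f z) <= sbern N (fun j => rnorm (x - f j)) z.
Proof.
move=> /andP[z0 z1]; elim: N f => [|n ih] f /=; first by [].
have -> : x - (ofR c (1 - z) *: bern n f z + ofR c z *: bern n (f \o succn) z) =
    ofR c (1 - z) *: (x - bern n f z) + ofR c z *: (x - bern n (f \o succn) z).
  by rewrite !scalerBr addrACA -opprD -scalerDl -ofRD subrK ofR1 scale1r.
rewrite (le_trans (rnormD _ _))// !rnormZr !ger0_norm ?subr_ge0//.
by rewrite lerD// ler_wpM2l ?subr_ge0// ih.
Qed.

Definition expsum (l : seq (R * X)) (a : R) : X :=
  \sum_(p <- l) ofR c (expR (p.1 * a)) *: p.2.

Lemma expsum_cat l1 l2 a : expsum (l1 ++ l2) a = expsum l1 a + expsum l2 a.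
Proof. by rewrite /expsum big_cat. Qed.

Definition expsum_opp (l : seq (R * X)) := [seq (p.1, - p.2) | p <- l].

Lemma expsum_oppE l a : expsum (expsum_opp l) a = - expsum l a.
Proof.
rewrite /expsum big_map/= -sumrN; apply: eq_bigr => p _.
by rewrite scalerN.
Qed.

(** The factor [z = e^(-a)] lowers an exponent by 1, so the recursion of [bern] becomes one on the
    exponents, starting from the weight [e^(s a)]. *)
Fixpoint bern_seq (s : R) (N : nat) (f : nat -> X) : seq (R * X) :=
  if N is n.+1 then bern_seq s n f ++ expsum_opp (bern_seq (s - 1) n f) ++
    bern_seq (s - 1) n (f \o succn)
  else [:: (s, f 0%N)].

Lemma expsum_bern_seq s N f a :
  expsum (bern_seq s N f) a = ofR c (expR (s * a)) *: bern N f (expR (- a)).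
Proof.
elim: N s f => [|n ih] s f /=; first by rewrite /expsum big_seq1.
rewrite !expsum_cat expsum_oppE !ih.
have -> : expR ((s - 1) * a) = expR (s * a) * expR (- a).
  by rewrite -expRD; congr expR; ring.
rewrite addrA -scalerBl -ofRB scalerDr !scalerA -!ofRM.
by congr (ofR c _ *: _ + _); ring.
Qed.

(** The exponents have the form [s - j]; they must not vanish because the sums are later integrated
    by dividing by them. *)
Lemma bern_seq_neq0 s N f : (forall j, s != j%:R) ->
  all (fun p => p.1 != 0) (bern_seq s N f).
Proof.
elim: N s f => [|n ih] s f hs /=; first by rewrite andbT (hs 0%N).
have hs1 j : s - 1 != j%:R by rewrite subr_eq natr1.
by rewrite !all_cat all_map !ih.
Qed.

End bernstein.

Section semigroup_approx.
Context (R : realType) (c : scalar_kind) (X : completeNormedModType (scalars R c)).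
Variable T : R -> X -> X.
Hypothesis hT : strongly_continuous_semigroup T.
Variables (M : R) (w : nat).
Hypothesis M1 : 1 <= M.
Hypothesis TM : forall t x, 0 <= t -> rnorm (T t x) <= M * expR (w%:R * t) * rnorm x.

(** The half-integer keeps the exponents [W - j] away from 0. The excess of at least 1 over [w]
    bounds the rescaled orbit by [M z rnorm x] at [z = e^(-a)], a linear decay at [z = 0]. *)
Let W : R := w%:R + 3 / 2.

Let S (t : R) (x : X) : X := ofR c (expR (- (W * t))) *: T t x.

Let M0 : 0 < M. Proof. exact: lt_le_trans M1. Qed.

Let W0 : 0 < W. Proof. by rewrite ltr_wpDl. Qed.

Let linT t : 0 <= t -> linear (T t).
Proof. by move=> t0; have [/(_ t t0)[]] := hT. Qed.

Let S_bound t x : 0 <= t -> rnorm (S t x) <= M * expR (- t) * rnorm x.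
Proof.
move=> t0; rewrite rnormZr ger0_norm ?expR_ge0// mulrC -ler_pdivlMr ?expR_gt0//.
rewrite (le_trans (TM x t0))// [leRHS]mulrAC ler_wpM2r ?rnorm_ge0//.
rewrite -mulrA ler_pM2l// -expRN opprK -expRD ler_expR /W; nra.
Qed.

Let SD s t x : 0 <= s -> 0 <= t -> S (s + t) x = S s (S t x).
Proof.
move=> s0 t0; have [_ _ TD _] := hT.
rewrite /S TD// (linopZ (linT s0)) scalerA -ofRM -expRD.
by congr (ofR c (expR _) *: _); ring.
Qed.

Let S_cvg0 x (e : R) : 0 < e ->
  exists2 h : R, 0 < h & forall t, 0 <= t -> t < h -> rnorm (S t x - x) <= e.
Proof.
move=> e0; have e20 : 0 < e / 2 by rewrite divr_gt0.
have [h h0 hh] := semigroup_cvg0 hT x e20.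
have B0 : 0 < W * (rnorm x + 1) by rewrite mulr_gt0// ltr_wpDl ?rnorm_ge0.
exists (Num.min h (e / 2 / (W * (rnorm x + 1)))); first by rewrite lt_min h0 divr_gt0.
move=> t t0; rewrite lt_min ltr_pdivlMr// => /andP[th tx].
have -> : S t x - x = ofR c (expR (- (W * t))) *: (T t x - x)
    + ofR c (expR (- (W * t)) - 1) *: x.
  by rewrite scalerBr ofRB scalerBl ofR1 scale1r addrA subrK.
rewrite (le_trans (rnormD _ _))// !rnormZr.
have E1 : expR (- (W * t)) <= 1 by rewrite -expR0 ler_expR oppr_le0 mulr_ge0// ltW.
have E0 : 0 <= expR (- (W * t)) by exact: expR_ge0.
have E2 : 1 - W * t <= expR (- (W * t)) by exact: expR_ge1Dx.
rewrite ger0_norm// ler0_norm ?subr_le0//.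
have := hh t t0 th; have := rnorm_ge0 (T t x - x); have := rnorm_ge0 x.
move: E1 E0 E2 tx; set E := expR _; set a := rnorm (T t x - x); set b := rnorm x => E1 E0 E2 tx b0 a0 ae.
have : E * a <= a by rewrite ler_piMl.
have : - (E - 1) * b <= W * t * b by rewrite ler_wpM2r//; lra.
have : t * (W * (b + 1)) = W * t * b + W * t by ring.
have : 0 <= W * t by rewrite mulr_ge0// ltW.
lra.
Qed.

(* The rescaled orbit in the variable z = expR (- a); it is continuous at 0
   because W exceeds the growth rate of T. *)
Let g (x : X) (z : R) : X := if 0 < z then S (- ln z) x else 0.

(** If the times of [z] and [y] differ by less than [h], strong continuity makes the difference at
    most [e]. Otherwise [z] and [y] differ by at least a fixed fraction of the larger one, and the
    crude bound on the orbit is itself proportional to the larger one. *)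
Let g_modulus x (e : R) : 0 < e -> exists2 C : R, 0 <= C &
  forall z y, 0 <= z <= 1 -> 0 <= y <= 1 -> rnorm (g x z - g x y) <= e + C * `|z - y|.
Proof.
move=> e0.
have [h h0 hh] := S_cvg0 x (divr_gt0 e0 M0).
pose q := 1 - expR (- h).
have q0 : 0 < q by rewrite subr_gt0 -expR0 ltr_expR oppr_lt0.
have q1 : q <= 1 by rewrite gerBl expR_ge0.
pose C := M * ((M + 1) * rnorm x) / q.
have C0 : 0 <= C.
  by rewrite divr_ge0 ?(ltW q0)// !mulr_ge0 ?rnorm_ge0// ?addr_ge0// ltW.
exists C => //.
have key z y : 0 <= z -> z <= y -> y <= 1 -> rnorm (g x z - g x y) <= e + C * (y - z).
  move=> z0 zy y1; rewrite /g.
  have [y0|y0] := ltP 0 y; last first.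
    have -> : (0 < z) = false by apply/negbTE; rewrite -leNgt (le_trans zy).
    by rewrite subrr rnorm0 addr_ge0 ?(ltW e0)// mulr_ge0// subr_ge0.
  have b0 : 0 <= - ln y by rewrite oppr_ge0 ln_le0.
  have Eb : expR (- - ln y) = y by rewrite opprK lnK.
  have [zp|zn] := ltP 0 z; last first.
    have {zn} -> : z = 0 by apply/eqP; rewrite eq_le zn z0.
    rewrite sub0r rnormN subr0 (le_trans (S_bound _ b0))// Eb.
    rewrite -[leLHS]add0r lerD ?(ltW e0)// mulrAC ler_wpM2r ?(ltW y0)//.
    rewrite /C -!mulrA ler_pM2l// mulrA ler_pdivlMr//.
    rewrite mulrC ler_wpM2r ?rnorm_ge0// (le_trans q1)// lerDr ltW//.
  pose r := - ln z - - ln y.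
  have r0 : 0 <= r by rewrite subr_ge0 lerN2 ler_ln.
  have -> : - ln z = - ln y + r by rewrite /r; ring.
  rewrite SD//.
  have -> : S (- ln y) (S r x) - S (- ln y) x = S (- ln y) (S r x - x).
    by rewrite /S -scalerBr (linopB (linT b0)).
  rewrite (le_trans (S_bound _ b0))// Eb.
  have [rh|hr] := ltP r h.
    rewrite -[leLHS]addr0 lerD//; last by rewrite mulr_ge0// subr_ge0.
    have := hh r r0 rh; rewrite ler_pdivlMr// => H.
    rewrite mulrAC (le_trans _ H)// [leRHS]mulrC ler_piMr//.
    by rewrite mulr_ge0 ?rnorm_ge0// ltW.
  have zE : z = y * expR (- r).
    by rewrite -{1}Eb -expRD (_ : _ + _ = ln z) ?lnK// /r; ring.
  have yz : y * q <= y - z.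
    rewrite zE /q mulrBr mulr1 lerB// ler_pM2l// ler_expR lerN2//.
  rewrite -[leLHS]add0r lerD ?(ltW e0)//.
  apply: (@le_trans _ _ (C * (y * q))); last by rewrite ler_wpM2l.
  have -> : C * (y * q) = M * y * ((M + 1) * rnorm x).
    by rewrite /C; field; rewrite gt_eqF.
  rewrite ler_wpM2l ?mulr_ge0 ?(ltW M0) ?(ltW y0)//.
  rewrite (le_trans (rnormD _ _))// rnormN mulrDl mul1r lerD2r.
  rewrite (le_trans (S_bound _ r0))// ler_wpM2r ?rnorm_ge0// ler_piMr ?(ltW M0)//.
  by rewrite -expR0 ler_expR oppr_le0.
move=> z y /andP[z0 z1] /andP[y0 y1].
have [zy|yz] := leP z y.
  by rewrite distrC ger0_norm ?subr_ge0// key.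
by rewrite rnormBC ger0_norm ?subr_ge0 ?(ltW yz)// key// ltW.
Qed.

Let WnN j : W != j%:R.
Proof.
apply/eqP => H.
have : (2 * w + 3)%N%:R = (2 * j)%N%:R :> R.
  by rewrite natrD !natrM -H /W; field.
move/eqP; rewrite eqr_nat => /eqP /(congr1 odd).
by rewrite oddD !oddM.
Qed.

Lemma semigroup_expsum x (e : R) : 0 < e -> exists l : seq (R * X),
  all (fun p => p.1 != 0) l /\
  forall a, 0 <= a -> rnorm (T a x - expsum l a) <= e * expR ((w%:R + 3 / 2) * a).
Proof.
move=> e0; have e20 : 0 < e / 2 by rewrite divr_gt0.
have [C C0 hC] := g_modulus x e20.
(* This makes the variance term [C^2 / (e N)] at most [e / 4]. *)
pose N := (Num.truncn (4 * C ^+ 2 / e ^+ 2)).+1.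
have N0 : 0 < N%:R :> R by rewrite ltr0n.
have hN : 4 * C ^+ 2 < N%:R * e ^+ 2.
  by rewrite -ltr_pdivrMr ?exprn_gt0// truncnS_gt.
exists (bern_seq W N (fun j => g x (j%:R / N%:R))); split; first exact: bern_seq_neq0.
move=> a a0; rewrite -/W expsum_bern_seq.
set z := expR (- a).
have z01 : 0 <= z <= 1 by rewrite expR_ge0/= -expR0 ler_expR oppr_le0.
have -> : T a x = ofR c (expR (W * a)) *: g x z.
  rewrite /g expR_gt0 expRK opprK /S scalerA -ofRM -expRD subrr expR0 ofR1.
  by rewrite scale1r.
rewrite -scalerBr rnormZr ger0_norm ?expR_ge0// mulrC ler_wpM2r ?expR_ge0//.
rewrite (le_trans (rnorm_bern _ _ _ z01))//.
(* The inequality [y <= e / 4 + y^2 / e] replaces the linear modulus by a quadratic one, whose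
   binomial mean is given by [sbern_sqr]; together with the tolerance [e / 2] the constant is
   [3 / 4 * e]. *)
pose b := C ^+ 2 / e / N%:R ^+ 2.
apply: (@le_trans _ _ (sbern N (fun j => 3 / 4 * e + b * (j%:R - N%:R * z) ^+ 2) z)).
  apply: ler_sbern => // j jN.
  have jN01 : 0 <= (j%:R / N%:R : R) <= 1.
    by rewrite divr_ge0//= ler_pdivrMr// mul1r ler_nat.
  rewrite (le_trans (hC _ _ z01 jN01))//.
  have -> : b * (j%:R - N%:R * z) ^+ 2 = (C * `|z - j%:R / N%:R|) ^+ 2 / e.
    rewrite exprMn real_normK ?num_real// /b; field.
    by rewrite !gt_eqF.
  set y := C * _.
  have : 0 <= (y - e / 2) ^+ 2 / e by rewrite divr_ge0 ?sqr_ge0// ltW.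
  have -> : (y - e / 2) ^+ 2 / e = y ^+ 2 / e - y + e / 4.
    by field; rewrite gt_eqF.
  lra.
rewrite sbern_sqr subrr expr0n/= addr0.
have zz : z * (1 - z) <= 1 by case/andP: z01; nra.
have b0 : 0 <= b by rewrite /b !divr_ge0 ?sqr_ge0 ?(ltW e0).
have : b * (N%:R * z * (1 - z)) <= b * N%:R.
  by rewrite ler_wpM2l// -mulrA ler_piMr// ltW.
have : b * N%:R <= e / 4.
  rewrite /b (_ : _ * _ = C ^+ 2 / (e * N%:R)); last by field; rewrite !gt_eqF.
  rewrite ler_pdivrMr ?mulr_gt0//.
  by move: hN; rewrite expr2 [e ^+ 2]expr2; lra.
lra.
Qed.

End semigroup_approx.

(** * The generator and the mean value inequality *)

Lemma near_at_right0 (R : realType) (P : R -> Prop) :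
  (\forall h \near 0^'+, P h) <->
  exists2 e : R, 0 < e & forall h, 0 < h -> h < e -> P h.
Proof.
split.
  rewrite /at_right/= near_withinE => /nbhs_ballP[e /= e0 he].
  exists e => // h h0 hlt; apply: he => //.
  by rewrite /ball/= sub0r normrN gtr0_norm.
move=> [e e0 he]; rewrite /at_right/= near_withinE; apply/nbhs_ballP.
exists e => // h; rewrite /ball/= sub0r normrN => hlt h0; apply: he => //.
by rewrite (le_lt_trans (ler_norm _)).
Qed.

Section generator.
Context (R : realType) (c : scalar_kind) (X : completeNormedModType (scalars R c)).
Variable T : R -> X -> X.

Lemma gen_cvg x (e : R) : gen_dom T x -> 0 < e ->
  exists2 h : R, 0 < h &
    forall t, 0 < t -> t < h -> rnorm (gen T x - diff_quotient T x t) < e.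
Proof.
move=> xD e0; apply/near_at_right0.
have : diff_quotient T x h @[h --> 0^'+] --> gen T x by exact: xD.
by move/cvg_rnormP; exact.
Qed.

Lemma genP x y :
  (forall e : R, 0 < e -> exists2 h : R, 0 < h &
     forall t, 0 < t -> t < h -> rnorm (y - diff_quotient T x t) < e) ->
  gen_dom T x /\ gen T x = y.
Proof.
move=> H.
have xy : diff_quotient T x h @[h --> 0^'+] --> y.
  by apply/cvg_rnormP => e e0; apply/near_at_right0; exact: H.
split; first by apply/cvg_ex; exists y.
by apply: cvg_lim => //; exact: norm_hausdorff.
Qed.

End generator.

(** It follows from [1 + x <= e^x <= 1 / (1 - x)]. *)
Lemma expR_taylor1 (R : realType) (x : R) : `|x| <= 1 / 2 ->
  `|expR x - 1 - x| <= 2 * x ^+ 2.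
Proof.
rewrite ler_norml => /andP[x1 x2].
have h1 : 1 + x <= expR x := expR_ge1Dx x.
have h2 : 1 - x <= (expR x)^-1 by rewrite -expRN; exact: expR_ge1Dx.
have E0 := expR_gt0 x.
have h3 : expR x * (1 - x) <= 1.
  by rewrite -[leRHS](mulfV (lt0r_neq0 E0)) ler_pM2l.
rewrite ger0_norm; last by lra.
have : 0 < 1 - x by lra.
have : 1 <= (1 - x) * (1 + x + 2 * x ^+ 2) by nra.
move: h3; set E := expR x; set y := 1 - x => h3 h4 y0.
have : y * E <= y * (1 + x + 2 * x ^+ 2) by lra.
by rewrite ler_pM2l//; lra.
Qed.

Section mean_value.
Context (R : realType) (c : scalar_kind) (X : completeNormedModType (scalars R c)).

(** The interval is cut into equal steps shorter than [d] and the increments are added. Only forward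
    increments enter, which is what a generator defined by right-hand quotients controls. *)
Lemma increment_bound (F : R -> X) (a B : R) : 0 <= a -> F 0 = 0 ->
  (forall e : R, 0 < e -> exists2 d : R, 0 < d & forall b h : R,
     0 <= b -> 0 < h -> h < d -> b + h <= a -> rnorm (F (b + h) - F b) <= h * (B + e)) ->
  rnorm (F a) <= a * B.
Proof.
rewrite le_eqVlt => /predU1P[<-|a0] F0 hF; first by rewrite F0 rnorm0 mul0r.
apply/ler_addgt0Pr => e e0.
have [d d0 hd] := hF (e / a) (divr_gt0 e0 a0).
pose N := (Num.truncn (a / d)).+1; pose h := a / N%:R.
have N0 : 0 < N%:R :> R by rewrite ltr0n.
have h0 : 0 < h by rewrite divr_gt0.
have h_d : h < d.
  by rewrite /h ltr_pdivrMr// mulrC -ltr_pdivrMr// truncnS_gt.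
have hi i : (i <= N)%N -> rnorm (F (i%:R * h)) <= i%:R * h * (B + e / a).
  elim: i => [_|i ih iN]; first by rewrite !mul0r F0 rnorm0.
  have := ih (ltnW iN).
  have b0 : 0 <= i%:R * h by rewrite mulr_ge0// ltW.
  have : i%:R * h + h <= a.
    rewrite -[X in _ + X]mul1r -mulrDl natr1 /h mulrCA ger_pMr//.
    by rewrite ler_pdivrMr// mul1r ler_nat.
  move=> /(hd _ _ b0 h0 h_d).
  rewrite -natr1 [(_ + 1) * h]mulrDl mul1r.
  have := rnormD (F (i%:R * h + h) - F (i%:R * h)) (F (i%:R * h)).
  by rewrite subrK (mulrDl (i%:R * h) h); lra.
have := hi N (leqnn N).
have -> : N%:R * h = a by rewrite /h mulrC divfK// gt_eqF.
by rewrite mulrDr [a * (e / a)]mulrC divfK ?gt_eqF.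
Qed.

(** The integral of [expsum l] from 0 to [a], when the exponents are nonzero. *)
Definition primsum (l : seq (R * X)) (a : R) : X :=
  \sum_(p <- l) ofR c ((expR (p.1 * a) - 1) / p.1) *: p.2.

Lemma primsum_increment (l : seq (R * X)) (A e : R) :
  all (fun p => p.1 != 0) l -> 0 < e ->
  exists2 d : R, 0 < d & forall a h : R, 0 <= a -> a <= A -> 0 < h -> h < d ->
    rnorm (ofR c h *: expsum l a - (primsum l (a + h) - primsum l a)) <= h * e.
Proof.
elim: l e => [|[s x] l ih] e.
  move=> _ e0; exists 1 => // a h _ _ h0 _.
  by rewrite /expsum /primsum !big_nil scaler0 !subr0 rnorm0 mulr_ge0// ltW.
move=> /= /andP[s0 ls] e0.
have e20 : 0 < e / 2 by rewrite divr_gt0.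
have [d d0 hd] := ih _ ls e20.
have sp : 0 < `|s| by rewrite normr_gt0.
(* The second-order Taylor error of the new term on [[0, A]] is at most [h^2 K]; adding 1 to the
   norm keeps [K] positive when [x = 0]. *)
pose K := 2 * `|s| * expR (`|s| * A) * (rnorm x + 1).
have K0 : 0 < K by rewrite !mulr_gt0 ?expR_gt0// ltr_wpDl ?rnorm_ge0.
exists (Num.min d (Num.min (1 / 2 / `|s|) (e / 2 / K))).
  by rewrite !lt_min d0 !divr_gt0.
move=> a h a0 aA h0; rewrite !lt_min => /and3P[h_d].
rewrite !ltr_pdivlMr// => hs hK.
rewrite /expsum /primsum !big_cons -/(expsum l a) -/(primsum l a) -/(primsum l (a + h)) /=.
have -> (u v u1 v1 u0 v0 : X) : ofR c h *: (u + v) - ((u1 + v1) - (u0 + v0)) =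
    (ofR c h *: u - (u1 - u0)) + (ofR c h *: v - (v1 - v0)).
  by rewrite scalerDr (opprD u0) (addrACA u1) opprD addrACA.
rewrite (le_trans (rnormD _ _))// [e]splitr [leRHS]mulrDr lerD ?hd//.
rewrite scalerA -ofRM -scalerBl -ofRB -scalerBl -ofRB rnormZr.
have -> : h * expR (s * a) - ((expR (s * (a + h)) - 1) / s - (expR (s * a) - 1) / s) =
    - (expR (s * a) / s * (expR (s * h) - 1 - s * h)).
  by rewrite mulrDr expRD; field.
rewrite normrN normrM normf_div (ger0_norm (expR_ge0 (s * a))).
have sh : `|s * h| <= 1 / 2 by rewrite normrM (gtr0_norm h0) mulrC; lra.
have E1 : expR (s * a) <= expR (`|s| * A).
  rewrite ler_expR; apply: (@le_trans _ _ (`|s| * a)).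
    by rewrite ler_wpM2r// ler_norm.
  by rewrite ler_wpM2l.
apply: (@le_trans _ _ (expR (`|s| * A) / `|s| * (2 * (s * h) ^+ 2) * (rnorm x + 1))).
  have Ea0 : 0 <= expR (s * a) / `|s| by rewrite divr_ge0 ?expR_ge0.
  apply: ler_pM; rewrite ?rnorm_ge0 ?lerDl ?mulr_ge0//.
  apply: ler_pM => //; last exact: expR_taylor1.
  by rewrite ler_wpM2r ?invr_ge0.
have -> : expR (`|s| * A) / `|s| * (2 * (s * h) ^+ 2) * (rnorm x + 1) = h * (h * K).
  rewrite exprMn -[s ^+ 2]real_normK ?num_real// /K; field.
  by rewrite gt_eqF.
by rewrite ler_pM2l//; lra.
Qed.

Context (T : R -> X -> X).
Hypothesis hT : strongly_continuous_semigroup T.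

(** The right derivatives of [T a x - x] and [primsum l a] are [T a (gen T x)] and [expsum l a],
    whose difference is bounded by the nondecreasing [e]. This stands in for integrating the orbit
    of [gen T x]. *)
Lemma semigroup_mean_value (x : X) (l : seq (R * X)) (e : R -> R) :
  gen_dom T x -> all (fun p => p.1 != 0) l ->
  {in [pred a | 0 <= a] &, {homo e : a b / a <= b}} ->
  (forall a, 0 <= a -> rnorm (T a (gen T x) - expsum l a) <= e a) ->
  forall a, 0 <= a -> rnorm (T a x - x - primsum l a) <= a * e a.
Proof.
move=> xD l0 ndE he A A0.
have [bT T0 TD _] := hT.
have [M [M1 [w TM]]] := semigroup_growth hT.
have M0 : 0 < M by exact: lt_le_trans M1.
(* The increment of the orbit at [a] is [T a] applied to the increment at 0; a bound for [T a] on
   [[0, A]] makes the convergence of the quotients uniform in [a]. *)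
pose K := M * expR (w%:R * A).
have K0 : 0 < K by rewrite mulr_gt0 ?expR_gt0.
apply: (@increment_bound (fun a => T a x - x - primsum l a)) => //.
  rewrite T0 subrr sub0r /primsum big1 ?oppr0// => p _.
  by rewrite mulr0 expR0 subrr mul0r ofR0 scale0r.
move=> r r0; have r20 : 0 < r / 2 by rewrite divr_gt0.
have [d1 d10 hd1] := gen_cvg xD (divr_gt0 r20 K0).
have [d2 d20 hd2] := primsum_increment A l0 r20.
exists (Num.min d1 d2); first by rewrite lt_min d10.
move=> a h a0 h0; rewrite lt_min => /andP[h1 h2] ahA.
have aA : a <= A by rewrite (le_trans _ ahA)// lerDl ltW.
have [lTa _] := bT a a0.
have -> : T (a + h) x - x - primsum l (a + h) - (T a x - x - primsum l a) =
   ofR c h *: T a (diff_quotient T x h - gen T x) + ofR c h *: (T a (gen T x) - expsum l a)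
   + (ofR c h *: expsum l a - (primsum l (a + h) - primsum l a)).
  have G (u v z y1 q1 p1 p0 : X) :
    u - z - p1 - (v - z - p0) = (u - v - y1) + (y1 - q1) + (q1 - (p1 - p0)).
    rewrite [u - v - y1 + _]addrA subrK addrA subrK.
    by rewrite !(opprD, opprK) addrACA; congr (_ + _); rewrite addrACA addNr addr0.
  rewrite TD ?(ltW h0)// (G _ _ _ (ofR c h *: T a (gen T x)) (ofR c h *: expsum l a)).
  rewrite [in RHS]scalerBr; congr (_ + _ + _).
  rewrite (linopB lTa) scalerBr /diff_quotient (linopZ lTa) scalerA -ofRM.
  by rewrite mulfV ?gt_eqF// ofR1 scale1r (linopB lTa).
rewrite (le_trans (rnormD _ _))//.
apply: (@le_trans _ _ (h * (r / 2) + h * e A + h * (r / 2))); last first.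
  by rewrite -!mulrDr ler_pM2l//; lra.
rewrite lerD ?hd2// (le_trans (rnormD _ _))// !rnormZr (gtr0_norm h0) lerD//.
  rewrite ler_pM2l// (le_trans (TM _ _ a0))// -ler_pdivlMl; last first.
    by rewrite mulr_gt0 ?expR_gt0.
  rewrite rnormBC (le_trans (ltW (hd1 h h0 h1)))// mulrC ler_pM2r//.
  rewrite lef_pV2 ?posrE ?mulr_gt0 ?expR_gt0//.
  by rewrite ler_pM2l// ler_expR ler_wpM2l.
by rewrite ler_pM2l// (le_trans (he a a0))// ndE.
Qed.

End mean_value.

(** * Admissible kernels and the coefficients of Phi *)

Section kernel_bounds.
Context (R : realType) (k : R -> R -> R).
Hypothesis hk : admissible k.

Local Notation mu := (@lebesgue_measure R).

Lemma kernel_measurable :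
  measurable_fun setT ((fun p : R * R => k p.1 p.2) \_ [set p | 0 < p.1 /\ 0 < p.2]).
Proof.
have mQ : measurable [set p : R * R | 0 < p.1 /\ 0 < p.2].
  have : measurable_fun setT (fun p : R * R => (0 < p.1) && (0 < p.2)).
    by apply: measurable_and; apply: measurable_fun_ltr.
  move=> /(_ measurableT [set true] Logic.I); rewrite setTI.
  by congr measurable; apply/seteqP; split => p /= => [/andP//|[-> ->]].
by have [mk _] := hk; apply/(measurable_restrictT _ mQ).
Qed.

Lemma kernel_section_measurable (t : R) : 0 < t -> measurable_fun `]0, t[ (k t).
Proof.
move=> t0; apply: (@eq_measurable_fun _ _ _ _ _
    (((fun p : R * R => k p.1 p.2) \_ [set p | 0 < p.1 /\ 0 < p.2]) \o pair t)).
  by move=> s; rewrite inE/= in_itv/= => /andP[s0 _]; rewrite patchE mem_set.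
apply: measurable_funTS; apply: measurableT_comp; first exact: kernel_measurable.
exact: pair1_measurable.
Qed.

Lemma mu_itv0 (t : R) : 0 <= t -> mu `]0, t[%classic = t%:E.
Proof.
move=> t0; rewrite lebesgue_measure_itv/= lte_fin; case: ltP => [_|t1].
  by rewrite oppr0 adde0.
by congr EFin; apply/eqP; rewrite eq_le t0 t1.
Qed.

(** With [p = 1 + eps], the exponents are [a = 1/p - alpha], possibly negative, and [b = 1 - 1/p].
    Positivity of [b] gives smallness on small sets, and [a + b = 1 - alpha > 0] gives smallness of
    the whole mass for small [t]. *)
Lemma kernel_hoelder : exists a b : R, [/\ 0 < b, 0 < a + b &
  forall T : R, 0 < T -> exists2 K : R, 0 <= K & forall t : R, 0 < t -> t <= T ->
    forall A, measurable A -> A `<=` `]0, t[ ->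
    (\int[mu]_(s in A) `|k t s|%:E <= (K * t `^ a * fine (mu A) `^ b)%:E)%E].
Proof.
have [_ [alpha [eps [/andP[a0 a1] e0 hN]]]] := hk.
pose p := 1 + eps; have p0 : 0 < p by rewrite /p; lra.
have p1 : p^-1 < 1 by rewrite invf_lt1// /p; lra.
exists (p^-1 - alpha), (1 - p^-1); split; [lra|lra|] => T T0.
have := hN T T0; set N := ereal_sup _ => Nfin.
have ubN (t : R) : 0 < t -> t <= T -> ((t `^ (alpha - p^-1))%:E *
    'N[mu]_(p%:E)[EFin \o (k t \_ `]0%R, t[)] <= N)%E.
  move=> t0 tT; apply: ereal_sup_ubound; exists t => //=.
  by rewrite in_itv/= t0.
have N0 : (0 <= N)%E.
  by apply: le_trans (ubN T T0 (lexx _)); rewrite mule_ge0 ?Lnorm_ge0 ?lee_fin ?powR_ge0.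
exists (fine N); first exact: fine_ge0.
move=> t t0 tT A mA At.
have mAfin : (mu A <= t%:E)%E.
  by rewrite -(mu_itv0 (ltW t0)) le_measure ?inE.
have mAf : mu A \is a fin_num by rewrite ge0_fin_numE// (le_lt_trans mAfin)// ltry.
pose f := k t \_ `]0, t[.
have mf : measurable_fun setT f.
  by apply/(measurable_restrictT _ (measurable_itv _)); exact: kernel_section_measurable.
pose b := 1 - p^-1; have b0 : 0 < b by rewrite /b; lra.
have -> : (\int[mu]_(s in A) `|k t s|%:E = 'N[mu]_1[EFin \o (f \* \1_A)%R])%E.
  rewrite Lnorm1 [LHS]integral_mkcond; apply: eq_integral => s _.
  rewrite /= /f !patchE indicE; case: (boolP (s \in A)) => sA.
    by rewrite mulr1 ifT// inE; apply: At; rewrite -inE.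
  by rewrite mulr0 normr0.
have mI : measurable_fun setT (\1_A : R -> R) by exact: measurable_indic.
have := @hoelder _ _ R mu f \1_A p b^-1 mf mI p0.
rewrite invr_gt0 invrK => /(_ b0); rewrite /b addrC subrK => /(_ erefl) H.
apply: (le_trans H).
have -> : ('N[mu]_((1 - p^-1)^-1%:E)[EFin \o \1_A] = (fine (mu A) `^ (1 - p^-1))%:E)%E.
  rewrite unlock invrK -poweR_EFin fineK//; congr (_ `^ _)%E.
  transitivity (\int[mu]_(x in setT) (\1_A x)%:E)%E; last by rewrite integral_indic// setIT.
  apply: eq_integral => s _ /=.
  rewrite indicE; case: (s \in A) => /=; first by rewrite normr1 powR1.
  by rewrite normr0 powR0// invr_eq0 gt_eqF.
rewrite EFinM lee_wpmul2r ?lee_fin ?powR_ge0//.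
have tp : 0 < t `^ (alpha - p^-1) by rewrite powR_gt0.
have -> : ('N[mu]_p%:E[EFin \o f] =
    ((t `^ (alpha - p^-1))^-1)%:E * ((t `^ (alpha - p^-1))%:E * 'N[mu]_(p%:E)[EFin \o f]))%E.
  by rewrite muleA -EFinM mulVf ?mul1e// gt_eqF.
rewrite -powRN opprB EFinM muleC lee_wpmul2r ?lee_fin ?powR_ge0//.
by rewrite fineK ?ubN// ge0_fin_numE.
Qed.

Lemma powR_small (a e : R) : 0 < a -> 0 < e -> exists2 x : R, 0 < x & x `^ a <= e.
Proof.
move=> a0 e0; exists (e `^ a^-1); first exact: powR_gt0.
by rewrite -powRrM mulVf ?gt_eqF// powRr1// ltW.
Qed.

Lemma kernel_L1 : exists2 g : R, 0 < g & forall T : R, 0 < T ->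
  exists2 K : R, 0 <= K & forall t : R, 0 < t -> t <= T ->
    (\int[mu]_(s in `]0%R, t[) `|k t s|%:E <= (K * t `^ g)%:E)%E.
Proof.
have [a [b [b0 ab0 H]]] := kernel_hoelder.
exists (a + b) => // T T0; have [K K0 hK] := H T T0; exists K => // t t0 tT.
apply: (le_trans (hK t t0 tT _ (measurable_itv _) (@subset_refl _ _))).
rewrite mu_itv0 ?(ltW t0)//= -mulrA -powRD ?lexx//.
by apply/implyP => _; rewrite gt_eqF.
Qed.

(* The exponential weight makes the Volterra operator with kernel k a strict
   contraction; away from the diagonal by the decay of the weight, near the
   diagonal by Hoelder's inequality. *)
Lemma kernel_weighted (T e : R) : 0 < T -> 0 < e -> exists2 b : R, 0 <= b &
  forall t : R, 0 < t -> t <= T ->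
  (\int[mu]_(s in `]0%R, t[) (`|k t s| * expR (b * s))%:E <= (e * expR (b * t))%:E)%E.
Proof.
move=> T0 e0.
have [a [b [b0 ab0 H]]] := kernel_hoelder.
have [K K0 hK] := H T T0.
have K1 : 0 < K + 1 by rewrite ltr_wpDl.
(* For [t <= t0] the whole mass of the kernel is already at most [e]. *)
have [t0 t00 ht0] := powR_small ab0 (divr_gt0 e0 K1).
(* A bound for [t^a] on [[t0, T]]; as [a] may be negative, it is obtained from [t^(a+b) t^(-b)]. *)
pose K2 := T `^ (a + b) * t0 `^ (- b) + 1.
have K20 : 0 < K2 by rewrite ltr_wpDl// mulr_ge0// powR_ge0.
have e20 : 0 < e / 2 by rewrite divr_gt0.
have [tau tau0 htau] := powR_small b0 (divr_gt0 e20 (mulr_gt0 K1 K20)).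
pose C := (K + 1) * T `^ (a + b) + 1.
have C1 : 0 < C by rewrite ltr_wpDl// mulr_ge0 ?powR_ge0// ltW.
(* Over a distance [tau] the weight drops at least by the factor [e / (2 C)], where [C] bounds the
   mass of the kernel. *)
pose be := `|ln (C / (e / 2))| / tau.
have be0 : 0 <= be by rewrite divr_ge0// ltW.
have hbe : expR (- (be * tau)) * C <= e / 2.
  have Cp : 0 < C / (e / 2) by rewrite divr_gt0.
  have -> : e / 2 = expR (- ln (C / (e / 2))) * C.
    by rewrite expRN lnK ?posrE// invf_div divfK// gt_eqF.
  by rewrite /be divfK ?gt_eqF// ler_pM2r// ler_expR lerN2 ler_norm.
exists be => // t tp tT.
have mkt := kernel_section_measurable tp.
have mw : measurable_fun `]0, t[ (fun s => expR (be * s)).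
  by apply: measurable_funTS; apply: measurableT_comp.
have mi : measurable_fun `]0, t[ (fun s => `|k t s|%:E).
  by apply/measurable_EFinP; exact: measurableT_comp.
have L1 : (\int[mu]_(s in `]0%R, t[) `|k t s|%:E <= (K * t `^ (a + b))%:E)%E.
  apply: (le_trans (hK t tp tT _ (measurable_itv _) (@subset_refl _ _))).
  rewrite mu_itv0 ?(ltW tp)//= -mulrA -powRD ?lexx//.
  by apply/implyP => _; rewrite gt_eqF.
have [tt0|t0t] := leP t t0.
  apply: (@le_trans _ _ (\int[mu]_(s in `]0%R, t[) ((expR (be * t))%:E * `|k t s|%:E))%E).
    apply: ge0_le_lower_integral => s; first by rewrite lee_fin mulr_ge0 ?expR_ge0.
    rewrite /= in_itv/= => /andP[s0 st]; rewrite -EFinM lee_fin mulrC.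
    by rewrite ler_wpM2r// ler_expR ler_wpM2l// ltW.
  rewrite ge0_integralZl_EFin ?expR_ge0// (mulrC e) EFinM lee_wpmul2l ?lee_fin ?expR_ge0//.
  apply: (le_trans L1); rewrite lee_fin.
  have : t `^ (a + b) <= t0 `^ (a + b).
    by rewrite ge0_ler_powR ?nnegrE// ltW.
  move=> /le_trans/(_ ht0); rewrite ler_pdivlMr//; have := powR_ge0 t (a + b); nra.
pose A1 := `]t - tau, t[%classic.
pose A := `]0, t[%classic `&` A1.
have mA1 : measurable A1 by exact: measurable_itv.
have mA : measurable A by apply: measurableI => //; exact: measurable_itv.
have LA : (\int[mu]_(s in A) `|k t s|%:E <= (e / 2)%:E)%E.
  apply: (le_trans (hK t tp tT _ mA _)); first by move=> s [].
  rewrite lee_fin.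
  have ta : t `^ a <= K2.
    have -> : t `^ a = t `^ (a + b) * t `^ (- b).
      by rewrite -powRD ?addrK//; apply/implyP => _; rewrite gt_eqF.
    apply: (@le_trans _ _ (T `^ (a + b) * t0 `^ (- b))); last by rewrite lerDl.
    rewrite ler_pM ?powR_ge0//; first by rewrite ge0_ler_powR ?nnegrE// ltW.
    rewrite !powRN lef_pV2 ?posrE ?powR_gt0//.
    by rewrite ge0_ler_powR ?nnegrE// ltW.
  have mAt : fine (mu A) <= tau.
    have mtau : mu A1 = tau%:E.
      rewrite /A1 lebesgue_measure_itv/= lte_fin gtrBl tau0 -EFinB opprB addrC subrK//.
    have AA : (mu A <= mu A1)%E by apply: le_measure; rewrite ?inE// => s [].
    rewrite -lee_fin -mtau fineK//.
    by rewrite ge0_fin_numE// (le_lt_trans AA)// mtau ltry.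
  have : fine (mu A) `^ b <= tau `^ b.
    by rewrite ge0_ler_powR ?nnegrE ?fine_ge0// ltW.
  move=> /le_trans/(_ htau); rewrite ler_pdivlMr ?mulr_gt0//.
  have := powR_ge0 (fine (mu A)) b; have := powR_ge0 t a.
  move: ta; set x := t `^ a; set y := _ `^ b => xK x0 y0 h.
  have : K * x <= (K + 1) * K2 by rewrite ler_pM//; lra.
  move=> h2; apply: le_trans h; rewrite mulrC.
  by rewrite ler_wpM2l.
rewrite integral_mkcondr in LA.
have mi1 : measurable_fun `]0, t[ ((fun s => `|k t s|%:E) \_ A1).
  by apply/measurable_restrict => //; exact: measurable_funS mi.
apply: (@le_trans _ _ (\int[mu]_(s in `]0%R, t[) ((expR (be * t))%:E *
    (((fun s => `|k t s|%:E) \_ A1) s + (expR (- (be * tau)))%:E * `|k t s|%:E)))%E).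
  apply: ge0_le_lower_integral => s; first by rewrite lee_fin mulr_ge0 ?expR_ge0.
  rewrite /= in_itv/= => /andP[s0 st]; rewrite patchE.
  case: ifPn => sA; last first.
    rewrite add0e -!EFinM lee_fin mulrA -expRD mulrC ler_wpM2r// ler_expR.
    rewrite -mulrN -mulrDr ler_wpM2l// leNgt; apply/negP => h; move/negP: sA; apply.
    by rewrite inE /A1/= in_itv/= h.
  rewrite -(EFinM (expR (- (be * tau)))) -EFinD -EFinM lee_fin mulrC ler_pM ?expR_ge0//.
    by rewrite ler_expR ler_wpM2l// ltW.
  by rewrite lerDl mulr_ge0 ?expR_ge0.
rewrite ge0_integralZl_EFin ?expR_ge0//; last 2 first.
- by move=> s _; rewrite adde_ge0 ?mule_ge0 ?lee_fin ?expR_ge0// patchE; case: ifP.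
- by apply: emeasurable_funD => //; exact: measurable_funeM.
rewrite (mulrC e) EFinM lee_wpmul2l ?lee_fin ?expR_ge0//.
rewrite ge0_integralD//; last 2 first.
- by move=> s _; rewrite patchE; case: ifP => // _; rewrite lee_fin.
- exact: measurable_funeM.
rewrite ge0_integralZl_EFin ?expR_ge0// [e]splitr EFinD leeD//.
apply: (@le_trans _ _ ((expR (- (be * tau)))%:E * (K * t `^ (a + b))%:E)%E).
  by rewrite lee_wpmul2l ?lee_fin ?expR_ge0.
rewrite -EFinM lee_fin (le_trans _ hbe)// ler_wpM2l ?expR_ge0//.
have : t `^ (a + b) <= T `^ (a + b).
  by rewrite ge0_ler_powR ?nnegrE// ltW.
rewrite /C; have := powR_ge0 t (a + b); nra.
Qed.

End kernel_bounds.

Section Rintegral_bound.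
Context d (S : measurableType d) (R : realType) (mu : {measure set S -> \bar R}).

Lemma Rintegral_bound (D : set S) (f : S -> R) (C : R) : measurable D ->
  measurable_fun D f -> (\int[mu]_(a in D) `|f a|%:E <= C%:E)%E ->
  mu.-integrable D (EFin \o f) /\ `|\int[mu]_(a in D) f a| <= C.
Proof.
move=> mD mf fC.
have i_f : mu.-integrable D (EFin \o f).
  apply/integrableP; split; first exact/measurable_EFinP.
  by apply: (le_lt_trans fC); rewrite ltry.
split=> //; rewrite (le_trans (le_normr_Rintegral mD i_f))//.
rewrite /Rintegral -lee_fin fineK// ge0_fin_numE ?integral_ge0//.
by apply: (le_lt_trans fC); rewrite ltry.
Qed.

End Rintegral_bound.

Section coefficients.
Context (R : realType) (k : R -> R -> R).
Hypothesis hk : admissible k.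

Local Notation mu := (@lebesgue_measure R).
Local Notation coef := (Phi_coef k).

(** Integrability is not yet known at this stage, so Tonelli's theorem is applied to the positive
    and negative parts separately. *)
Lemma Phi_coef_measurable n : measurable_fun setT (coef n).
Proof.
elim: n => [|n ih] /=; first exact: measurable_cst.
pose kq := (fun p : R * R => k p.1 p.2) \_ [set p | 0 < p.1 /\ 0 < p.2].
(* The moving domain []0, t[] is absorbed into the integrand, which also gives the value 0 for
   [t <= 0]. *)
pose F (p : R * R) := if (0 < p.2) && (p.2 < p.1) then kq p * coef n p.2 else 0.
have mF : measurable_fun setT F.
  apply: measurable_fun_ifT.
  - by apply: measurable_and; apply: measurable_fun_ltr.
  - apply: measurable_funM; first exact: (kernel_measurable hk).
    by apply: measurableT_comp.
  - exact: measurable_cst.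
have mFe : measurable_fun setT (EFin \o F) by exact/measurable_EFinP.
rewrite (_ : (fun t => _) = fine \o (fun t => (\int[mu]_s (EFin \o F) (t, s))%E)).
  apply: measurableT_comp; first exact: fine_measurable.
  rewrite (_ : (fun t => _) = (fubini_F mu (EFin \o F)^\+ \- fubini_F mu (EFin \o F)^\-)%E).
    apply: emeasurable_funB; apply: measurable_fun_fubini_tonelli_F => //.
      exact: measurable_funepos.
    exact: measurable_funeneg.
  by apply/funext => t; rewrite [LHS]integralE /fubini_F; congr (_ - _)%E; apply: eq_integral => s _; rewrite ?funeposE ?funenegE.
apply/funext => t /=; rewrite /Rintegral.
have [t0|t0] := ltP 0 t.
  congr fine; rewrite integral_mkcond; apply: eq_integral => s _.
  rewrite patchE /F /=; case: ifPn; rewrite ?inE ?notin_setE/= in_itv/=.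
    by move=> /[dup] /andP[s0 _] ->; rewrite /kq patchE mem_set.
  by move/negP/negbTE => ->.
rewrite integral0_eq// => s _; rewrite /F/=.
case: ifPn => // /andP[s0 st].
by have := lt_le_trans (lt_trans s0 st) t0; rewrite ltxx.
Qed.

Lemma Phi_coef_weighted (T e : R) (w : R -> R) : 0 <= e ->
  measurable_fun setT w ->
  (forall t, 0 < t -> t <= T -> 1 <= w t) ->
  (forall t : R, 0 < t -> t <= T ->
    (\int[mu]_(s in `]0%R, t[) (`|k t s| * w s)%:E <= (e * w t)%:E)%E) ->
  forall n t, 0 < t -> t <= T -> `|coef n t| <= e ^+ n * w t.
Proof.
move=> e0 mw w1 hw; elim=> [t t0 tT|n ih t t0 tT] /=.
  by rewrite normr1 expr0 mul1r w1.
rewrite t0; apply: (proj2 (Rintegral_bound _ _ _)) => //.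
  apply: measurable_funM; first exact: kernel_section_measurable.
  by apply: measurable_funTS; exact: Phi_coef_measurable.
apply: (@le_trans _ _ (\int[mu]_(s in `]0%R, t[) ((e ^+ n)%:E * (`|k t s| * w s)%:E))%E).
  apply: ge0_le_lower_integral => s; first by rewrite lee_fin.
  rewrite /= in_itv/= => /andP[s0 st]; rewrite -EFinM lee_fin normrM mulrCA.
  by rewrite ler_wpM2l// ih// (le_trans (ltW st)).
rewrite ge0_integralZl_EFin ?exprn_ge0//; last 2 first.
- move=> s; rewrite /= in_itv/= => /andP[s0 st]; rewrite lee_fin mulr_ge0//.
  by rewrite (le_trans ler01)// w1// (le_trans (ltW st)).
- apply/measurable_EFinP; apply: measurable_funM; last exact: measurable_funTS.
  by apply: measurableT_comp => //; exact: kernel_section_measurable.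
by rewrite exprSr -mulrA EFinM lee_wpmul2l ?lee_fin ?exprn_ge0// hw.
Qed.

(** The ratio [e] is arbitrary: this is the quantitative form of the entireness of [Phi], uniform in
    [t]. The weight of [kernel_weighted] only affects the constant. *)
Lemma Phi_coef_bound (T e : R) : 0 < T -> 0 < e ->
  exists2 C : R, 0 <= C & forall n t, 0 <= t -> t <= T -> `|coef n t| <= C * e ^+ n.
Proof.
move=> T0 e0; have [b b0 hb] := kernel_weighted hk T0 e0.
exists (expR (b * T)); first exact: expR_ge0.
have bT1 : 1 <= expR (b * T) by rewrite -expR0 ler_expR mulr_ge0// ltW.
move=> n t; rewrite le_eqVlt => /predU1P[<- _|t0 tT].
  case: n => [|n] /=; first by rewrite normr1 expr0 mulr1.
  by rewrite ltxx normr0 mulr_ge0 ?expR_ge0 ?exprn_ge0// ltW.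
have mE : measurable_fun setT (fun t : R => expR (b * t)) by apply: measurableT_comp.
apply: (le_trans (Phi_coef_weighted (ltW e0) mE _ hb n t0 tT)).
  by move=> s s0 _; rewrite -expR0 ler_expR mulr_ge0// ltW.
by rewrite mulrC ler_wpM2r ?exprn_ge0 ?(ltW e0)// ler_expR ler_wpM2l.
Qed.

End coefficients.

Section geometric_series.
Context (R : realType) (a : nat -> R) (C q : R).
Hypothesis q0 : 0 <= q.
Hypothesis q2 : q <= 2^-1.
Hypothesis ha : forall n, `|a n| <= C * q ^+ n.

Let C0 : 0 <= C.
Proof. by have := ha 0%N; rewrite expr0 mulr1; apply: le_trans. Qed.

Lemma series_geometric_tail N m : (N <= m)%N ->
  `|series a m - series a N| <= 2 * C * q ^+ N.
Proof.
(* The strengthened bound survives the addition of a term because [q <= 1/2]. *)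
move=> Nm; suff : `|series a m - series a N| <= 2 * C * (q ^+ N - q ^+ m).
  move=> /le_trans; apply; rewrite ler_wpM2l ?mulr_ge0// gerBl exprn_ge0//.
rewrite -(subnK Nm); elim: (m - N)%N => [|n ih].
  by rewrite add0n !subrr normr0 mulr0.
rewrite addSn seriesSr /= exprS.
have := ha (n + N)%N; have := ler_normD (series a (n + N) - series a N) (a (n + N)%N).
rewrite addrAC; have : C * (q * q ^+ (n + N)) <= C * (2^-1 * q ^+ (n + N)).
  by rewrite ler_wpM2l// ler_wpM2r// exprn_ge0.
lra.
Qed.

Lemma series_geometric_cvg : cvgn (series a).
Proof.
apply: cauchy_cvg; apply/cauchy_ballP => e e0; near_simpl.
have D0 : 0 < 2 * C + 1 by rewrite ltr_wpDl// mulr_ge0.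
have [N hN] : exists N, (2 * C + 1) * q ^+ N < e / 2.
  have : (2 * C + 1) * q ^+ n @[n --> \oo] --> (2 * C + 1) * 0.
    by apply: cvgMr; apply: cvg_expr; rewrite ger0_norm// (le_lt_trans q2)// invf_lt1// ltr1n.
  rewrite mulr0 => /cvgrPdist_lt/(_ _ (divr_gt0 e0 (ltr0Sn _ 1)))[N _ /(_ N (leqnn N))].
  rewrite sub0r normrN => h; exists N.
  by rewrite (le_lt_trans (ler_norm _)).
have P : 0 <= q ^+ N by rewrite exprn_ge0.
exists ([set n | (N <= n)%N], [set n | (N <= n)%N]); first by split; exists N.
move=> [n m] [/= hn hm]; rewrite /ball/=.
have := series_geometric_tail hn; have := series_geometric_tail hm.
have := ler_normB (series a n - series a N) (series a m - series a N).
by rewrite opprB addrA subrK; lra.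
Qed.

Lemma series_geometric_dist N :
  `|limn (series a) - series a N| <= 2 * C * q ^+ N.
Proof.
have h : `|series a m - series a N| @[m --> \oo] --> `|limn (series a) - series a N|.
  by apply: cvg_norm; apply: cvgB; [exact: series_geometric_cvg|exact: cvg_cst].
rewrite -(cvg_lim _ h)//; apply: limr_le; first exact: cvgP h.
by exists N => // m /= Nm; exact: series_geometric_tail.
Qed.

End geometric_series.

(** * The function Phi on the real axis and its Volterra equation *)

Section real_Phi.
Context (R : realType) (k : R -> R -> R).
Hypothesis hk : admissible k.

Local Notation mu := (@lebesgue_measure R).
Local Notation coef := (Phi_coef k).

Definition rPhi (t l : R) : R := limn (series (fun n => coef n t * l ^+ n)).

Lemma rPhi_geometric (T l : R) : 0 < T -> exists2 C : R, 0 <= C &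
  forall t, 0 <= t -> t <= T -> forall n, `|coef n t * l ^+ n| <= C * 2^-1 ^+ n.
Proof.
move=> T0; have l1 : 0 < `|l| + 1 by rewrite ltr_wpDl.
have e0 : 0 < 2^-1 / (`|l| + 1) by rewrite divr_gt0.
have [C C0 hC] := Phi_coef_bound hk T0 e0.
exists C => // t t0 tT n; rewrite normrM normrX.
apply: (@le_trans _ _ (C * (2^-1 / (`|l| + 1)) ^+ n * (`|l| + 1) ^+ n)).
  rewrite ler_pM ?exprn_ge0 ?hC// lerXn2r ?nnegrE ?addr_ge0//.
  by rewrite lerDl.
by rewrite -mulrA -exprMn divfK// gt_eqF.
Qed.

Lemma rPhi_cvg t l : 0 <= t -> cvgn (series (fun n => coef n t * l ^+ n)).
Proof.
move=> t0; have [C _ hC] := rPhi_geometric l (ltr_pwDr ltr01 t0).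
apply: (@series_geometric_cvg _ _ C 2^-1) => //; apply: hC => //.
by rewrite lerDl.
Qed.

Lemma rPhi_dist (T l : R) : 0 < T -> exists2 C : R, 0 <= C &
  forall t, 0 <= t -> t <= T -> forall n,
    `|rPhi t l - series (fun n => coef n t * l ^+ n) n| <= C * 2^-1 ^+ n.
Proof.
move=> T0; have [C C0 hC] := rPhi_geometric l T0.
exists (2 * C); first by rewrite mulr_ge0.
by move=> t t0 tT n; apply: series_geometric_dist => //; exact: hC.
Qed.

Lemma rPhi_bound (T l : R) : 0 < T -> exists2 C : R, 0 <= C &
  forall t, 0 <= t -> t <= T -> `|rPhi t l| <= C.
Proof.
move=> T0; have [C C0 hC] := rPhi_dist l T0; exists C => // t t0 tT.
have := hC t t0 tT 0%N.
by rewrite expr0 mulr1 /series/= big_geq// subr0.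
Qed.

Lemma series_coef_measurable l n :
  measurable_fun setT (fun t => series (fun n => coef n t * l ^+ n) n).
Proof.
rewrite /series/=; apply: measurable_sum => i.
by apply: measurable_funM => //; exact: Phi_coef_measurable.
Qed.

Lemma rPhi_measurable (t l : R) : measurable_fun `]0, t[ (rPhi ^~ l).
Proof.
apply: (@measurable_fun_cvg _ _ _ _ (fun n t => series (fun n => coef n t * l ^+ n) n)).
  by move=> n; apply: measurable_funTS; exact: series_coef_measurable.
move=> s; rewrite /= in_itv/= => /andP[s0 _].
exact/rPhi_cvg/ltW.
Qed.

Lemma kernel_mul_bounded (t I B : R) (f : R -> R) : 0 < t -> 0 <= B ->
  (\int[mu]_(s in `]0%R, t[) `|k t s|%:E <= I%:E)%E ->
  measurable_fun `]0, t[ f -> (forall s, 0 < s -> s < t -> `|f s| <= B) ->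
  mu.-integrable `]0, t[ (EFin \o (fun s => k t s * f s)) /\
  `|\int[mu]_(s in `]0, t[) (k t s * f s)| <= B * I.
Proof.
move=> t0 B0 hI mf fB; have mkt := kernel_section_measurable hk t0.
apply: Rintegral_bound => //; first exact: measurable_funM.
apply: (@le_trans _ _ (\int[mu]_(s in `]0%R, t[) (B%:E * `|k t s|%:E))%E).
  apply: ge0_le_lower_integral => s; first by rewrite lee_fin.
  rewrite /= in_itv/= => /andP[s0 st]; rewrite -EFinM lee_fin normrM mulrC.
  by rewrite ler_wpM2r// fB.
rewrite ge0_integralZl_EFin//; last first.
  by apply/measurable_EFinP; exact: measurableT_comp.
by rewrite EFinM lee_wpmul2l// lee_fin.
Qed.

Lemma kernel_L1_bound t : 0 < t -> exists2 I : R, 0 <= I &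
  (\int[mu]_(s in `]0%R, t[) `|k t s|%:E <= I%:E)%E.
Proof.
move=> t0; have [g _ H] := kernel_L1 hk; have [K K0 hK] := H t t0.
by exists (K * t `^ g); [rewrite mulr_ge0// powR_ge0|exact: hK].
Qed.

Lemma rPhi_kernel_integrable (t l : R) : 0 < t ->
  mu.-integrable `]0, t[ (EFin \o (fun s => k t s * rPhi s l)).
Proof.
move=> t0; have [I I0 hI] := kernel_L1_bound t0.
have [C C0 hC] := rPhi_bound l t0.
apply: (proj1 (kernel_mul_bounded t0 C0 hI (@rPhi_measurable t l) _)) => s s0 st.
by rewrite hC// ltW.
Qed.

Lemma eq_of_geometric (x y C : R) : (forall n, `|x - y| <= C * 2^-1 ^+ n) -> x = y.
Proof.
move=> h; apply/eqP; rewrite -subr_eq0 -normr_eq0 eq_le normr_ge0 andbT.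
have hc : C * 2^-1 ^+ n @[n --> \oo] --> (C * 0 : R).
  by apply: cvgMr; apply: cvg_expr; rewrite ger0_norm//; lra.
rewrite mulr0 in hc; rewrite -(cvg_lim _ hc)//; apply: limr_ge; first exact: cvgP hc.
exact: nearW.
Qed.

(** Integrating a partial sum against [l * k t s] raises every index by one, so [S N] becomes
    exactly [S N.+1 - 1]; convergence uniform on []0, t[] gives the limit. At [l = 0] the identity
    yields [rPhi t 0 = 1]. *)
Lemma rPhi_volterra (t l : R) : 0 < t ->
  l * \int[mu]_(s in `]0, t[) (k t s * rPhi s l) = rPhi t l - 1.
Proof.
move=> t0; have [I I0 hI] := kernel_L1_bound t0.
have [C C0 hC] := rPhi_dist l t0.
pose S N s := series (fun n => coef n s * l ^+ n) N.
have iS N : mu.-integrable `]0, t[ (EFin \o (fun s => k t s * S N s)) /\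
    l * \int[mu]_(s in `]0, t[) (k t s * S N s) = S N.+1 t - 1.
  elim: N => [|N [ih1 ih2]].
    rewrite /S /series/= big_nat1 expr0 mulr1 subrr.
    have E s : k t s * \sum_(0 <= i < 0) (coef i s * l ^+ i) = 0.
      by rewrite big_geq// mulr0.
    split.
      rewrite (_ : EFin \o _ = cst 0%E); first exact: integrable0.
      by apply/funext => s /=; rewrite E.
    rewrite /Rintegral; under eq_integral do rewrite E.
    by rewrite integral0 mulr0.
  have [B B0 hB] := Phi_coef_bound hk t0 ltr01.
  have ic : mu.-integrable `]0, t[ (EFin \o (fun s => k t s * coef N s)).
    apply: (proj1 (kernel_mul_bounded t0 B0 hI _ _)).
      by apply: measurable_funTS; exact: Phi_coef_measurable.
    move=> s s0 st; have := hB N s (ltW s0) (ltW st).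
    by rewrite expr1n mulr1.
  have icl : mu.-integrable `]0, t[ (EFin \o (fun s => k t s * coef N s * l ^+ N)).
    rewrite (_ : EFin \o _ = fun s => ((k t s * coef N s)%R%:E * (l ^+ N)%:E)%E) //.
    exact: integrableZr.
  have E s : k t s * S N.+1 s = k t s * S N s + k t s * coef N s * l ^+ N.
    by rewrite /S seriesSr mulrDr mulrA.
  split.
    rewrite (_ : EFin \o _ = (fun s => (k t s * S N s)%R%:E +
        (k t s * coef N s * l ^+ N)%R%:E)%E).
      apply: integrableD => //.
    by apply/funext => s /=; rewrite E EFinD.
  under eq_Rintegral do rewrite E.
  rewrite RintegralD// mulrDr ih2 RintegralZr//.
  rewrite /S [in RHS]seriesSr /= t0 exprS; ring.
apply: (@eq_of_geometric _ _ (`|l| * (C * I) + C)) => N.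
have [iSN ESN] := iS N.
have -> : l * \int[mu]_(s in `]0, t[) (k t s * rPhi s l) - (rPhi t l - 1) =
    l * \int[mu]_(s in `]0, t[) (k t s * (rPhi s l - S N s)) - (rPhi t l - S N.+1 t).
  under [in RHS]eq_Rintegral do rewrite mulrBr.
  rewrite RintegralB//; last exact: rPhi_kernel_integrable.
  by rewrite mulrBr ESN; ring.
have hN : 0 <= C * 2^-1 ^+ N by rewrite mulr_ge0// exprn_ge0.
have [_ hI2] : mu.-integrable `]0, t[ (EFin \o (fun s => k t s * (rPhi s l - S N s))) /\
    `|\int[mu]_(s in `]0, t[) (k t s * (rPhi s l - S N s))| <= (C * 2^-1 ^+ N) * I.
  apply: kernel_mul_bounded => //.
    apply: measurable_funB; first exact: rPhi_measurable.
    by apply: measurable_funTS; exact: series_coef_measurable.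
  by move=> s s0 st; apply: hC; exact: ltW.
rewrite (le_trans (ler_normB _ _))// mulrDl lerD//.
  by rewrite normrM -mulrA ler_wpM2l// mulrAC.
rewrite (le_trans (hC t (ltW t0) (lexx _) N.+1))// ler_wpM2l// exprS.
by rewrite ler_piMl ?exprn_ge0//; lra.
Qed.

Lemma rPhi_small (l e : R) : 0 < e -> exists2 T : R, 0 < T &
  forall t, 0 < t -> t <= T -> `|rPhi t l - 1| <= e.
Proof.
move=> e0; have [g g0 H] := kernel_L1 hk; have [K K0 hK] := H 1 ltr01.
have [C C0 hC] := rPhi_bound l ltr01.
have D0 : 0 < `|l| * (C * K) + 1 by rewrite ltr_wpDl// !mulr_ge0.
have [T T0 hT] := powR_small g0 (divr_gt0 e0 D0).
exists (Num.min 1 T); first by rewrite lt_min ltr01.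
move=> t t0; rewrite le_min => /andP[t1 tT].
rewrite -rPhi_volterra// normrM.
have [_ h] := kernel_mul_bounded t0 C0 (hK t t0 t1) (@rPhi_measurable t l)
  (fun s s0 st => hC s (ltW s0) (le_trans (ltW st) t1)).
have : t `^ g <= T `^ g by rewrite ge0_ler_powR ?nnegrE// ltW.
move=> /le_trans/(_ hT); rewrite ler_pdivlMr// => h2.
apply: (le_trans (ler_wpM2l (normr_ge0 l) h)); apply: le_trans h2.
have := powR_ge0 t g; lra.
Qed.

Lemma Phi_real (t l : R) : 0 <= t -> Phi k t (l%:C)%C = ((rPhi t l)%:C)%C.
Proof.
move=> t0; have /cvgrPdist_lt cv := rPhi_cvg (l := l) t0.
apply: (@cvg_lim R[i]^o); first exact: norm_hausdorff.
apply/cvgrPdist_lt => e e0.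
have ee : ofR ComplexScalars (toR (e : scalars R ComplexScalars)) = e by rewrite ge0_ofRK// ltW.
have : 0 < toR (e : scalars R ComplexScalars).
  by rewrite -(ltr_ofR ComplexScalars) ee ofR0.
move=> /cv; apply: filterS => n h.
have -> : series (fun n => ((coef n t)%:C)%C * (l%:C)%C ^+ n : R[i]^o) n =
    ((series (fun n => coef n t * l ^+ n) n)%:C)%C.
  rewrite /series/= rmorph_sum; apply: eq_bigr => i _.
  by rewrite rmorphM rmorphXn.
by move: h; rewrite -(ltr_ofR ComplexScalars) -normr_ofR ee -rmorphB.
Qed.

End real_Phi.

(** * Exponential moments from the Laplace transform *)

Section exp_remainder.
Context (R : realType).

(* [(-1) ^ n] times the remainder of order n in the Taylor expansion of
   [expR (- x)] at 0. *)
Fixpoint exp_rem (n : nat) (x : R) : R :=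
  if n is m.+1 then x ^+ m / m`!%:R - exp_rem m x else expR (- x).

Lemma exp_rem0 n : exp_rem n.+1 0 = 0.
Proof.
elim: n => [|n ih]; first by rewrite /= expr0 fact0 invr1 mulr1 oppr0 expR0 subrr.
by rewrite [LHS]/= -/(exp_rem n.+1 0) ih subr0 expr0n mul0r.
Qed.

Lemma is_derive_exp_rem n (x : R) : is_derive x 1 (exp_rem n.+1) (exp_rem n x).
Proof.
elim: n => [|n ih].
  rewrite /= (_ : (fun x => _) = (fun x : R => 1 - expR (- x))); last first.
    by apply/funext => y; rewrite expr0 fact0 invr1 mulr1.
  have H : is_derive x 1 (expR \o -%R) (expR (- x) * - 1).
    by apply: is_derive1_comp; apply: is_deriveN.
  rewrite (_ : (fun y => _) = cst 1 - (expR \o -%R)); last exact/funext.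
  by apply: (is_derive_eq (is_deriveB (is_derive_cst _ _ _) H)); rewrite sub0r mulrN1 opprK.
have E : exp_rem n.+2 = (fun x => (n.+1`!%:R)^-1 *: x ^+ n.+1) - exp_rem n.+1.
  by apply/funext => y; rewrite [LHS]/= -/(exp_rem n.+1 y) mulrC.
have F : exp_rem n.+1 x = (n.+1`!%:R)^-1 *: (n.+1%:R * x ^+ n) - exp_rem n x.
  rewrite [LHS]/= factS natrM; congr (_ - _).
  by rewrite /GRing.scale/= invfM mulrACA mulVf ?pnatr_eq0// mul1r mulrC.
rewrite E F; apply: is_deriveB; apply: is_deriveZ.
have dX : 'D_1 (@GRing.exp R ^~ n.+1) x = n.+1%:R * x ^+ n.
  by rewrite exp_derive [LHS]mulr1.
by rewrite -dX; apply/derivableP/exprn_derivable.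
Qed.

(** Each remainder of order at least 1 vanishes at 0 and has the preceding one as its derivative, so
    the sign propagates. *)
Lemma exp_rem_ge0 n (x : R) : 0 <= x -> 0 <= exp_rem n x.
Proof.
elim: n x => [|n ih] x x0; first exact: expR_ge0.
rewrite -(exp_rem0 n).
apply: (@ger0_derive1_ndecry _ (exp_rem n.+1) 0) => //.
- by move=> y _; have := is_derive_exp_rem n y; case.
- move=> y; rewrite in_itv/= andbT => y0.
  by rewrite derive1E (@derive_val _ _ _ _ _ _ _ (is_derive_exp_rem n y)) ih// ltW.
- apply: continuous_subspaceT => y.
  apply: differentiable_continuous; apply/derivable1_diffP.
  by have := is_derive_exp_rem n y; case.
Qed.

Lemma exp_rem_le n (x : R) : 0 <= x -> exp_rem n x <= x ^+ n / n`!%:R.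
Proof. by move=> x0; have := exp_rem_ge0 n.+1 x0; rewrite /= subr_ge0. Qed.

Lemma exp_rem_measurable n : measurable_fun setT (exp_rem n).
Proof.
elim: n => [|n ih] /=; first by apply: measurableT_comp => //; exact: measurableT_comp.
by apply: measurable_funB => //; apply: measurable_funM => //; exact: measurable_funX.
Qed.

Lemma exp_rem_cvg n (x : R) : 0 <= x ->
  exp_rem n (m.+1%:R^-1 * x) / (m.+1%:R^-1) ^+ n @[m --> \oo] --> x ^+ n / n`!%:R.
Proof.
move=> x0.
have cv : x ^+ n / n`!%:R - m.+1%:R^-1 * (x ^+ n.+1 / n.+1`!%:R) @[m --> \oo] -->
    x ^+ n / n`!%:R - 0 * (x ^+ n.+1 / n.+1`!%:R).
  apply: cvgB; first exact: cvg_cst.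
  by apply: cvgM; [exact: cvg_harmonic|exact: cvg_cst].
rewrite mul0r subr0 in cv.
apply: (squeeze_cvgr _ cv (cvg_cst _)); apply: nearW => m.
set y := m.+1%:R^-1; have y0 : 0 < y by rewrite /y invr_gt0.
have yx : 0 <= y * x by rewrite mulr_ge0// ltW.
apply/andP; split.
  rewrite ler_pdivlMr ?exprn_gt0//.
  have := exp_rem_le n.+1 yx; rewrite /= lerBlDr -lerBlDl; apply: le_trans.
  rewrite !exprMn [y ^+ n.+1]exprS mulrBl.
  by rewrite le_eqVlt; apply/orP; left; apply/eqP; ring.
by rewrite ler_pdivrMr ?exprn_gt0// (le_trans (exp_rem_le n yx))// exprMn -mulrA mulrC.
Qed.

End exp_remainder.

Section moments.
Context (R : realType) (mu : {measure set R -> \bar R}) (c : nat -> R).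

Local Notation D := (`[0, +oo[%classic : set R).
Local Notation F l := (limn (series (fun n => c n * l ^+ n))).

Hypothesis c_small : forall e : R, 0 < e ->
  exists2 C : R, 0 <= C & forall n, `|c n| <= C * e ^+ n.
Hypothesis muD : (mu D < +oo)%E.
Hypothesis muF : forall l : R, 0 <= l -> \int[mu]_(a in D) expR (- (l * a)) = F (- l).

Let mD : measurable D. Proof. exact: measurable_itv. Qed.

(** The signed Taylor remainder of [F] at [- l], the counterpart of [exp_rem] on the transform side,
    with the same recursion. *)
Let frem (n : nat) (l : R) : R :=
  (-1) ^+ n * (F (- l) - series (fun n => c n * (- l) ^+ n) n).

Let fremS n l : frem n.+1 l = c n * l ^+ n - frem n l.
Proof.
rewrite /frem seriesSr /= exprS (exprNn l).
have : (-1) ^+ n * (-1) ^+ n = 1 :> R by rewrite -exprMn mulrNN mulr1 expr1n.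
set s := (-1) ^+ n => ss.
rewrite (_ : c n * l ^+ n = c n * (s * s) * l ^+ n); last by rewrite ss mulr1.
ring.
Qed.

Let frem_bound n : exists2 C : R, 0 <= C &
  forall l, 0 <= l -> l <= 1 -> `|frem n l - c n * l ^+ n| <= C * l ^+ n.+1.
Proof.
have h0 : 0 < 2^-1 :> R by [].
have [C C0 hC] := c_small h0.
exists (2 * C); first by rewrite mulr_ge0.
move=> l l0 l1.
have -> : frem n l - c n * l ^+ n = - frem n.+1 l by rewrite fremS opprB.
rewrite normrN /frem normrM normrX normrN normr1 expr1n mul1r.
(* With the ratio 1/2 taken from [c_small], the terms are dominated by powers of [l / 2], so the
   tail is geometric and keeps the factor [l ^+ n.+1]. *)
have q2 : l / 2 <= 2^-1 by rewrite ler_pdivrMr// mulVf.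
have ha m : `|c m * (- l) ^+ m| <= C * (l / 2) ^+ m.
  rewrite normrM normrX normrN (ger0_norm l0) exprMn mulrCA mulrC ler_wpM2l//.
  exact: exprn_ge0.
apply: (le_trans (series_geometric_dist _ q2 ha n.+1)).
  by rewrite divr_ge0.
rewrite ler_wpM2l ?mulr_ge0// lerXn2r ?nnegrE ?divr_ge0//.
by rewrite ler_pdivrMr// ler_peMr//; lra.
Qed.

Let exp_integrable l : 0 <= l -> mu.-integrable D (EFin \o (fun a : R => expR (- (l * a)))).
Proof.
move=> l0; apply: measurable_bounded_integrable => //.
  by apply: measurable_funTS; apply: measurableT_comp => //; exact: measurableT_comp.
exists 1; split => // M M1 a /=; rewrite in_itv/= andbT => a0.
rewrite ger0_norm ?expR_ge0// (le_trans _ (ltW M1))// -expR0 ler_expR.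
by rewrite oppr_le0 mulr_ge0.
Qed.

(* Upper bound by Fatou's lemma for the remainders rescaled by l ^ n, l -> 0;
   lower bound by [exp_rem_le]. *)
Let moment_step n :
  (forall l, 0 <= l -> mu.-integrable D (EFin \o (fun a : R => exp_rem n (l * a))) /\
     \int[mu]_(a in D) exp_rem n (l * a) = frem n l) ->
  (\int[mu]_(a in D) (a ^+ n / n`!%:R)%:E = (c n)%:E)%E.
Proof.
move=> H.
pose y m : R := m.+1%:R^-1.
have y0 m : 0 < y m by rewrite /y invr_gt0.
have y1 m : y m <= 1 by rewrite /y invf_le1// ler1n.
pose f m a := exp_rem n (y m * a) / y m ^+ n.
have f0 m a : 0 <= a -> 0 <= f m a.
  by move=> a0; rewrite divr_ge0 ?exprn_ge0 ?(ltW (y0 m))// exp_rem_ge0// mulr_ge0// ltW.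
have mf m : measurable_fun D (EFin \o f m).
  apply/measurable_EFinP; apply: measurable_funTS; apply: measurable_funM => //.
  by apply: measurableT_comp; [exact: exp_rem_measurable|exact: mulrl_measurable].
have fle m a : 0 <= a -> f m a <= a ^+ n / n`!%:R.
  move=> a0; rewrite ler_pdivrMr ?exprn_gt0// (le_trans (exp_rem_le n _))//.
    by rewrite mulr_ge0// ltW.
  by rewrite exprMn -mulrA mulrC.
have intf m : (\int[mu]_(a in D) (f m a)%:E = (frem n (y m) / y m ^+ n)%:E)%E.
  have [h1 h2] := H (y m) (ltW (y0 m)).
  under eq_integral do rewrite EFinM muleC.
  rewrite integralZl//.
  rewrite -h2 /Rintegral EFinM fineK 1?muleC//.
  exact: integrable_fin_num.
have cvf : (\int[mu]_(a in D) (f m a)%:E @[m --> \oo] --> (c n)%:E)%E.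
  under eq_fun do rewrite intf.
  apply: cvg_EFin; first exact: nearW.
  have [C C0 hC] := frem_bound n.
  have cvC : C * y m @[m --> \oo] --> C * 0.
    by apply: cvgMr; exact: cvg_harmonic.
  rewrite mulr0 in cvC.
  apply/cvgrPdist_le => e e0.
  move/cvgrPdist_le : cvC => /(_ e e0); apply: filterS => m.
  rewrite sub0r normrN => /(le_trans (ler_norm _)); apply: le_trans.
  have yn : 0 < y m ^+ n by rewrite exprn_gt0.
  have -> : c n - (fine \o (fun m => (frem n (y m) / y m ^+ n)%:E)) m =
      - ((frem n (y m) - c n * y m ^+ n) / y m ^+ n).
    by rewrite /= mulrBl mulfK ?gt_eqF// opprB.
  rewrite normrN normf_div (gtr0_norm yn) ler_pdivrMr// -mulrA -exprS.
  exact: hC (ltW (y0 m)) (y1 m).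
apply/eqP; rewrite eq_le; apply/andP; split; last first.
  rewrite -(cvg_lim _ cvf)//; apply: lime_le; first exact: cvgP cvf.
  apply: nearW => m; apply: ge0_le_lower_integral => a; rewrite /= in_itv/= andbT => a0.
    by rewrite lee_fin f0.
  by rewrite lee_fin fle.
apply: (@le_trans _ _ (\int[mu]_(a in D) limn_einf (fun m => (f m a)%:E))%E).
  rewrite le_eqVlt; apply/orP; left; apply/eqP; apply: eq_integral => a.
  rewrite inE/= in_itv/= andbT => a0.
  have cva : (f m a)%:E @[m --> \oo] --> (a ^+ n / n`!%:R)%:E.
    by apply: cvg_EFin; [exact: nearW|exact: exp_rem_cvg].
  by rewrite is_cvg_limn_einfE; [rewrite (cvg_lim _ cva)|exact: cvgP cva].
apply: (le_trans (fatou mu mD mf _)).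
  by move=> m a; rewrite /= in_itv/= andbT => a0; rewrite lee_fin f0.
by rewrite is_cvg_limn_einfE; [rewrite (cvg_lim _ cvf)|exact: cvgP cvf].
Qed.

(** The induction alternates with [moment_step]: order [n] gives the moment of order [n], hence
    integrability of [a^n], which permits the subtraction that defines order [n + 1]. *)
Let exp_rem_integral n l : 0 <= l ->
  mu.-integrable D (EFin \o (fun a : R => exp_rem n (l * a))) /\
  \int[mu]_(a in D) exp_rem n (l * a) = frem n l.
Proof.
elim: n l => [|n ih] l l0.
  split; first exact: exp_integrable.
  by rewrite /= muF// /frem expr0 mul1r /series/= big_geq// subr0.
have [i1 E1] := ih l l0.
have mom := moment_step ih.
have i2 : mu.-integrable D (EFin \o (fun a : R => a ^+ n / n`!%:R)).
  apply/integrableP; split.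
    apply/measurable_EFinP; apply: measurable_funTS; apply: measurable_funM => //.
  rewrite (eq_integral (fun a : R => (a ^+ n / n`!%:R)%:E)) ?mom ?ltry// => a.
  rewrite inE/= in_itv/= andbT => a0.
  by rewrite ger0_norm// divr_ge0// exprn_ge0.
have i3 : mu.-integrable D (EFin \o (fun a : R => l ^+ n * (a ^+ n / n`!%:R))).
  rewrite (_ : EFin \o _ = fun a : R => ((l ^+ n)%:E * (a ^+ n / n`!%:R)%:E)%E)//.
  exact: integrableZl.
have E a : exp_rem n.+1 (l * a) = l ^+ n * (a ^+ n / n`!%:R) - exp_rem n (l * a).
  by rewrite [LHS]/= exprMn mulrA.
split.
  rewrite (_ : EFin \o _ = fun a : R => ((l ^+ n * (a ^+ n / n`!%:R))%:E - (exp_rem n (l * a))%:E)%E).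
    exact: integrableB.
  by apply/funext => a; rewrite /= -/(exp_rem n.+1 _) E.
under eq_Rintegral do rewrite E.
rewrite RintegralB// E1 fremS RintegralZl//.
by rewrite /Rintegral mom/= mulrC.
Qed.

Lemma moment n : (\int[mu]_(a in D) (a ^+ n / n`!%:R)%:E = (c n)%:E)%E.
Proof. exact: moment_step (exp_rem_integral n). Qed.

(** For [l < 0] this is the hypothesis [muF]. For [l >= 0] the terms of the exponential series are
    nonnegative on [D], so sum and integral may be exchanged. *)
Lemma exp_moment l : mu.-integrable D (EFin \o (fun a : R => expR (l * a))) /\
  \int[mu]_(a in D) expR (l * a) = F l.
Proof.
have [l0|l0] := leP 0 l; last first.
  have nl0 : 0 <= - l by rewrite oppr_ge0 ltW.
  have := exp_integrable nl0; have := muF nl0; rewrite opprK.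
  have -> : (fun a : R => expR (- (- l * a))) = (fun a : R => expR (l * a)).
    by apply/funext => a; rewrite mulNr opprK.
  by [].
have cF : cvgn (series (fun n => c n * l ^+ n)).
  have e0 : 0 < 2^-1 / (l + 1) by rewrite divr_gt0// ltr_wpDl.
  have [C C0 hC] := c_small e0.
  apply: (@series_geometric_cvg _ _ C 2^-1) => // n.
  rewrite normrM normrX (ger0_norm l0).
  apply: (@le_trans _ _ (C * (2^-1 / (l + 1)) ^+ n * (l + 1) ^+ n)).
    by rewrite ler_pM ?exprn_ge0// lerXn2r ?nnegrE ?addr_ge0// lerDl.
  by rewrite -mulrA -exprMn divfK// gt_eqF// ltr_wpDl.
have I : (\int[mu]_(a in D) (expR (l * a))%:E = (F l)%:E)%E.
  have E a : 0 <= a -> ((expR (l * a))%:E = \sum_(n <oo) (l ^+ n * (a ^+ n / n`!%:R))%:E)%E.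
    move=> a0; rewrite /expR -EFin_lim; last exact: is_cvg_series_exp_coeff.
    congr (limn _); apply/funext => n /=; rewrite /series/= -sumEFin.
    by apply: eq_bigr => i _; rewrite /exp_coeff/= exprMn mulrA.
  rewrite (eq_integral (fun a : R => \sum_(n <oo) (l ^+ n * (a ^+ n / n`!%:R))%:E)%E); last first.
    by move=> a; rewrite inE/= in_itv/= andbT => /E.
  have mm n : measurable_fun D (fun a => (a ^+ n / n`!%:R)%:E).
    apply/measurable_EFinP; apply: measurable_funTS; apply: measurable_funM => //.
  rewrite integral_nneseries//; last 2 first.
  - move=> n; apply/measurable_EFinP; apply: measurable_funM => //.
    by apply/measurable_EFinP; exact: mm.
  - move=> n a; rewrite /= in_itv/= andbT => a0; rewrite lee_fin.
    by rewrite mulr_ge0 ?divr_ge0 ?exprn_ge0.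
  rewrite -EFin_lim//; congr (limn _); apply/funext => n /=.
  rewrite /series/= -sumEFin; apply: eq_bigr => i _.
  under eq_integral do rewrite EFinM.
  rewrite ge0_integralZl_EFin ?exprn_ge0//; last first.
    by move=> a; rewrite /= in_itv/= andbT => a0; rewrite lee_fin divr_ge0// exprn_ge0.
  by rewrite moment -EFinM mulrC.
split; last by rewrite /Rintegral I.
apply/integrableP; split.
  by apply/measurable_EFinP; apply: measurable_funTS; apply: measurableT_comp.
under eq_integral do rewrite gee0_abs ?lee_fin ?expR_ge0//.
by rewrite I ltry.
Qed.

End moments.

(** * Homogeneous kernels *)

Section lebesgue_scaling.
Context (R : realType).
Local Notation mu := (@lebesgue_measure R).

Lemma lebesgue_measure_scale (t : R) (t0 : 0 < t) (A : set R) : measurable A ->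
  (mu A = t%:E * pushforward mu ( *%R t : _ -> measurableTypeR R) A)%E.
Proof.
move=> mA.
have mt : measurable_fun setT ( *%R t : measurableTypeR R -> measurableTypeR R) by exact: mulrl_measurable.
pose t' := NngNum (ltW t0).
pose phi := *%R t : measurableTypeR R -> measurableTypeR R.
pose m : {measure set _ -> \bar R} := mscale t' (pushforward mu phi).
rewrite -[RHS]/(m mt A); apply: lebesgue_measure_unique => //= _ [[a b]] _ <-.
rewrite /m /= /mscale /= /pushforward /=.
rewrite (_ : _ @^-1` _ = `]a / t, b / t]%classic).
  rewrite !lebesgue_measure_itv/= !lte_fin ltr_pM2r ?invr_gt0//.
  case: ifPn => _; last by rewrite mule0.
  by rewrite -!EFinB -EFinM -mulrBl mulrC divfK// gt_eqF.
by apply/seteqP; split => x; rewrite /= !in_itv/= ltr_pdivrMr// ler_pdivlMr// mulrC.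
Qed.

Lemma ge0_integral_scale (t : R) (f : R -> \bar R) : 0 < t ->
  measurable_fun `]0, t[ f -> (forall s : R, 0 < s -> s < t -> (0 <= f s)%E) ->
  (\int[mu]_(s in `]0%R, t[) f s = t%:E * \int[mu]_(r in `]0%R, 1%R[) f (t * r)%R)%E.
Proof.
move=> t0 mf f0.
have mt : measurable_fun setT ( *%R t : measurableTypeR R -> measurableTypeR R) by exact: mulrl_measurable.
pose phi := *%R t : measurableTypeR R -> measurableTypeR R.
have f0' : {in `]0, t[%classic, forall y, (0 <= f y)%E}.
  by move=> s; rewrite inE/= in_itv/= => /andP[? ?]; exact: f0.
have -> : `]0, 1[%classic = phi @^-1` `]0, t[%classic.
  have E x : (t * x < t) = (x < 1) by rewrite -{2}[t]mulr1 ltr_pM2l.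
  by apply/seteqP; split => x; rewrite /= !in_itv/= pmulr_rgt0// E.
rewrite -(ge0_integral_pushforward mt mu _ mf f0')//.
pose m : {measure set _ -> \bar R} := pushforward mu phi.
rewrite -[RHS]/((NngNum (ltW t0))%:num%:E * \int[m mt]_(y in `]0%R, t[) f y)%E.
rewrite -ge0_integral_mscale//; last first.
  by move=> s Ds; apply: f0'; rewrite inE.
apply: eq_measure_integral => /= A mA _.
by rewrite (lebesgue_measure_scale t0 mA).
Qed.

Lemma Rintegral_scale (t : R) (g : R -> R) : 0 < t ->
  mu.-integrable `]0, t[ (EFin \o g) ->
  \int[mu]_(s in `]0, t[) g s = t * \int[mu]_(r in `]0, 1[) g (t * r).
Proof.
move=> t0 ig.
pose h r := g (t * r).
have mg : measurable_fun `]0, t[ (EFin \o g) by case/integrableP: ig.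
have Ep : (\int[mu]_(s in `]0%R, t[) (EFin \o g)^\+ s =
    t%:E * \int[mu]_(r in `]0%R, 1%R[) (EFin \o h)^\+ r)%E.
  rewrite ge0_integral_scale//; last exact: measurable_funepos.
  by congr (_ * _)%E; apply: eq_integral => r _; rewrite !funeposE.
have En : (\int[mu]_(s in `]0%R, t[) (EFin \o g)^\- s =
    t%:E * \int[mu]_(r in `]0%R, 1%R[) (EFin \o h)^\- r)%E.
  rewrite ge0_integral_scale//; last exact: measurable_funeneg.
  by congr (_ * _)%E; apply: eq_integral => r _; rewrite !funenegE.
have fin (x : \bar R) : (0 <= x)%E -> (t%:E * x < +oo)%E -> x \is a fin_num.
  by case: x => //=; rewrite gt0_muley ?lte_fin.
have fp : (\int[mu]_(r in `]0%R, 1%R[) (EFin \o h)^\+ r)%E \is a fin_num.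
  by apply: fin; [exact: integral_ge0|rewrite -Ep; exact: integral_funepos_lt_pinfty].
have fn : (\int[mu]_(r in `]0%R, 1%R[) (EFin \o h)^\- r)%E \is a fin_num.
  by apply: fin; [exact: integral_ge0|rewrite -En; exact: integral_funeneg_lt_pinfty].
move: Ep En fp fn.
set P := (\int[mu]_(r in `]0%R, 1%R[) (EFin \o h)^\+ r)%E.
set N := (\int[mu]_(r in `]0%R, 1%R[) (EFin \o h)^\- r)%E => Ep En fp fn.
transitivity (fine (t%:E * P - t%:E * N)%E).
  by congr fine; rewrite integralE Ep En.
transitivity (t * fine (P - N)%E); last by congr (_ * fine _); rewrite [RHS]integralE.
rewrite (fineB fp fn) fineB ?fin_numM//.
by rewrite !fineM//= mulrBr.
Qed.

End lebesgue_scaling.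

Section homogeneous_kernel.
Context (R : realType) (k : R -> R -> R) (theta : R).
Hypothesis hk : admissible k.
Hypothesis theta0 : 0 < theta.
Hypothesis hom : homogeneous k (theta - 1).

Local Notation coef := (Phi_coef k).

(** After the substitution [s = t r], each integration contributes [t * t^(theta - 1) = t^theta]. *)
Lemma Phi_coef_homogeneous n t : 0 < t ->
  coef n t = (t `^ theta) ^+ n * coef n 1.
Proof.
have ikc m s : 0 < s -> (@lebesgue_measure R).-integrable `]0, s[
    (EFin \o (fun r => k s r * coef m r)).
  move=> s0; have [I I0 hI] := kernel_L1_bound hk s0.
  have [B B0 hB] := Phi_coef_bound hk s0 ltr01.
  apply: (proj1 (kernel_mul_bounded hk s0 B0 hI _ _)).
    by apply: measurable_funTS; exact: Phi_coef_measurable.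
  by move=> r r0 rs; have := hB m r (ltW r0) (ltW rs); rewrite expr1n mulr1.
elim: n t => [|n ih] t t0; first by rewrite expr0 mul1r.
rewrite /= t0 ltr01 Rintegral_scale//; last exact: ikc.
have tE : t * t `^ (theta - 1) = t `^ theta.
  rewrite -{1}(powRr1 (ltW t0)) -powRD; first by rewrite addrC subrK.
  by apply/implyP => _; rewrite gt_eqF.
rewrite (_ : \int[_]_(r in _) _ = t `^ (theta - 1) * (t `^ theta) ^+ n *
    \int[@lebesgue_measure R]_(r in `]0, 1[) (k 1 r * coef n r)).
  by rewrite mulrA mulrA tE exprS.
rewrite -RintegralZl//; last exact: ikc.
apply: eq_Rintegral => r; rewrite inE/= in_itv/= => /andP[r0 r1].
rewrite hom ?r0// (ih (t * r)) ?mulr_gt0// (ih r r0) powRM ?ltW// exprMn.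
by ring.
Qed.

Lemma Phi_homogeneous t (l : R[i]) : 0 <= t ->
  Phi k t l = Phi k 1 (l * ((t `^ theta)%:C)%C).
Proof.
move=> t_ge0; rewrite /Phi.
suff -> : (fun n => ((coef n t)%:C)%C * l ^+ n : R[i]^o) =
    (fun n => ((coef n 1)%:C)%C * (l * ((t `^ theta)%:C)%C) ^+ n : R[i]^o) by [].
apply/funext => n; rewrite exprMn -rmorphXn/=.
(* At [t = 0] both sides keep only the term of order 0, because [0^theta = 0]. *)
move: t_ge0; rewrite le_eqVlt => /predU1P[<-|t0].
  rewrite powR0 ?gt_eqF//; case: n => [|n].
    by rewrite !expr0 !mulr1.
  by rewrite expr0n /= ltxx mulr0 mul0r mulr0.
rewrite (Phi_coef_homogeneous n t0) rmorphM/=.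
by rewrite [RHS]mulrA [RHS]mulrC mulrA.
Qed.

End homogeneous_kernel.

(** * Subordination *)

Section subordination.
Context (R : realType) (c : scalar_kind) (X : completeNormedModType (scalars R c)).
Variable T : R -> X -> X.
Hypothesis hT : strongly_continuous_semigroup T.
Variable k : R -> R -> R.
Hypothesis hk : admissible k.

Local Notation D := (`[0, +oo[%classic : set R).
Local Notation leb := (@lebesgue_measure R).

(** All that the operator estimates use of the law of [A(t)]; stated for a measure, it applies
    equally to the law of the scaled variable in (iii). *)
Definition real_laplace (mu : {measure set R -> \bar R}) (t : R) : Prop :=
  (mu D < +oo)%E /\
  forall l : R, 0 <= l -> \int[mu]_(a in D) expR (- (l * a)) = rPhi k t (- l).

(** The integral of [expsum l] against every measure with the transform prescribed at time [t]. *)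
Definition phisum (t : R) (l : seq (R * X)) : X :=
  \sum_(p <- l) ofR c (rPhi k t p.1) *: p.2.

Let mD : measurable D. Proof. exact: measurable_itv. Qed.

Section one_measure.
Variables (mu : {measure set R -> \bar R}) (t : R).
Hypothesis t0 : 0 <= t.
Hypothesis hmu : real_laplace mu t.

Let muD : (mu D < +oo)%E. Proof. by case: hmu. Qed.

Lemma laplace_exp l : mu.-integrable D (EFin \o (fun a => expR (l * a))) /\
  \int[mu]_(a in D) expR (l * a) = rPhi k t l.
Proof.
apply: exp_moment => //; last by case: hmu.
move=> e e0; have [C C0 hC] := Phi_coef_bound hk (ltr_pwDr ltr01 t0) e0.
by exists C => // n; apply: hC => //; rewrite lerDl.
Qed.

Lemma laplace_exp_integral l : (\int[mu]_(a in D) (expR (l * a))%:E = (rPhi k t l)%:E)%E.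
Proof.
have [il El] := laplace_exp l.
by rewrite -El /Rintegral fineK//; exact: integrable_fin_num.
Qed.

Lemma rPhi_ge0 l : 0 <= rPhi k t l.
Proof. by have [_ <-] := laplace_exp l; apply: Rintegral_ge0 => a _; exact: expR_ge0. Qed.

Lemma tame_expsum l : tame mu D (@expsum R c X l) (phisum t l).
Proof.
apply: (@tame_sum _ _ _ _ _ mu D mD muD _ l (fun p a => ofR c (expR (p.1 * a)) *: p.2)) => p.
have [ip <-] := laplace_exp p.1.
exact: (tame_scale mD muD).
Qed.

Lemma scaled_exp_integral_le (r s : R) : 0 <= r ->
  (\int[mu]_(a in D) (r * expR (s * a))%:E <= (r * rPhi k t s)%:E)%E.
Proof.
move=> r0; under eq_integral do rewrite EFinM.
rewrite ge0_integralZl_EFin//; last by case: (laplace_exp s) => /integrableP[].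
by rewrite laplace_exp_integral.
Qed.

Lemma scaled_exp_measurable (r s : R) : measurable_fun D (fun a => r * expR (s * a)).
Proof.
apply: measurable_funTS; apply: measurable_funM => //.
by apply: measurableT_comp.
Qed.

Lemma tame_Phi_op x : tame mu D (fun a => T a x) (Phi_op T mu x).
Proof.
suff [v tv] : exists v, tame mu D (fun a => T a x) v.
  by rewrite /Phi_op (tame_integral mD muD tv).
have [M [M1 [w TM]]] := semigroup_growth hT.
pose h (a : R) := expR ((w%:R + 3 / 2) * a).
apply: (@tame_lim _ _ _ _ _ mu D mD muD _ h (rPhi k t (w%:R + 3 / 2))).
- by have [/integrableP[/measurable_EFinP]] := laplace_exp (w%:R + 3 / 2).
- by move=> a _; exact: expR_ge0.
- by rewrite laplace_exp_integral.
move=> e e0; have [l [_ hl]] := semigroup_expsum hT M1 TM x e0.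
exists (expsum l), (phisum t l); split; first exact: tame_expsum.
by move=> a; rewrite /= in_itv/= andbT => /hl.
Qed.

Lemma Phi_op_dist x l (e s : R) : 0 <= e ->
  (forall a, 0 <= a -> rnorm (T a x - expsum l a) <= e * expR (s * a)) ->
  rnorm (Phi_op T mu x - phisum t l) <= e * rPhi k t s.
Proof.
move=> e0 he.
apply: (tame_dist mD muD (tame_Phi_op x) (tame_expsum l) (scaled_exp_measurable e s)).
  by move=> a; rewrite /= in_itv/= andbT => /he.
exact: scaled_exp_integral_le.
Qed.

Lemma Phi_op_bound : exists2 K : R, 0 < K & forall x, rnorm (Phi_op T mu x) <= K * rnorm x.
Proof.
have [M [M1 [w TM]]] := semigroup_growth hT.
have M0 : 0 <= M by exact: le_trans M1.
exists (M * rPhi k t w%:R + 1) => [|x]; first by rewrite ltr_wpDl// mulr_ge0// rPhi_ge0.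
(* The empty exponential sum serves as the approximant, so that the growth bound of [T] is the
   error. *)
have : rnorm (Phi_op T mu x - phisum t [::]) <= M * rnorm x * rPhi k t w%:R.
  apply: Phi_op_dist; first by rewrite mulr_ge0// rnorm_ge0.
  by move=> a a0; rewrite /expsum big_nil subr0 mulrAC TM.
rewrite /phisum big_nil subr0 => /le_trans; apply.
by rewrite mulrDl mul1r mulrAC lerDl rnorm_ge0.
Qed.

Lemma Phi_op_linear : linear (Phi_op T mu).
Proof.
move=> a x y; have [bT _ _ _] := hT.
have ba : bounded_linear_operator (fun x : X => a *: x).
  split; first by move=> b u v; rewrite scalerDr !scalerA mulrC.
  by exists (toR `|a|) => u; rewrite rnormZ.
have tx := tameD mD muD (tame_op mD ba (tame_Phi_op x)) (tame_Phi_op y).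
rewrite [LHS](tame_integral mD muD (v := a *: Phi_op T mu x + Phi_op T mu y))//.
apply: eq_tame tx => b; rewrite /= in_itv/= andbT => b0.
by have [lT _] := bT b b0; rewrite lT.
Qed.

Lemma Phi_op_commute h x : 0 <= h -> T h (Phi_op T mu x) = Phi_op T mu (T h x).
Proof.
move=> h0; have [bT _ TD _] := hT.
rewrite [RHS](tame_integral mD muD (v := T h (Phi_op T mu x)))//.
apply: eq_tame (tame_op mD (bT h h0) (tame_Phi_op x)) => b.
by rewrite /= in_itv/= andbT => b0; rewrite -!TD// addrC.
Qed.

(** The operator commutes with difference quotients and is bounded, so their limit passes through
    it. *)
Lemma Phi_op_gen x : gen_dom T x ->
  gen_dom T (Phi_op T mu x) /\ gen T (Phi_op T mu x) = Phi_op T mu (gen T x).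
Proof.
move=> xD; apply: genP => e e0; have [K K0 hK] := Phi_op_bound.
have [h h0 hh] := gen_cvg xD (divr_gt0 e0 K0).
exists h => // s s0 sh.
have -> : diff_quotient T (Phi_op T mu x) s = Phi_op T mu (diff_quotient T x s).
  rewrite /diff_quotient Phi_op_commute ?ltW// (linopZ Phi_op_linear).
  by rewrite (linopB Phi_op_linear).
rewrite -(linopB Phi_op_linear) (le_lt_trans (hK _))// mulrC -ltr_pdivlMr//.
exact: hh.
Qed.

End one_measure.

Lemma Phi_op_unique mu nu t x : 0 <= t -> real_laplace mu t -> real_laplace nu t ->
  Phi_op T mu x = Phi_op T nu x.
Proof.
move=> t0 hmu hnu; apply: rnorm_eq => e e0.
have [M [M1 [w TM]]] := semigroup_growth hT.
pose r := rPhi k t (w%:R + 3 / 2).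
have r0 : 0 <= r by exact: (rPhi_ge0 t0 hmu).
have e10 : 0 < e / (2 * r + 1) by rewrite divr_gt0// ltr_wpDl// mulr_ge0.
have [l [_ hl]] := semigroup_expsum hT M1 TM x e10.
have := Phi_op_dist t0 hmu (ltW e10) hl; have := Phi_op_dist t0 hnu (ltW e10) hl.
rewrite rnormBC -/r => h1 h2.
rewrite (le_trans (rnormB_split (phisum t l) _ _))// (le_trans (lerD h2 h1))//.
rewrite -mulrDr mulrAC ler_pdivrMr; last by rewrite ltr_wpDl// mulr_ge0.
by rewrite ler_pM2l//; lra.
Qed.

Section evolution.
Variable mu : R -> {measure set R -> \bar R}.
Hypothesis hmu : forall t, 0 <= t -> real_laplace (mu t) t.
Variable u0 : X.
Hypothesis u0D : gen_dom T u0.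

Local Notation u t := (Phi_op T (mu t) u0).
Local Notation y := (gen T u0).

Let rPhi0 t : 0 < t -> rPhi k t 0 = 1.
Proof. by move=> /(rPhi_volterra hk 0); rewrite mul0r => /esym/eqP; rewrite subr_eq0 => /eqP. Qed.

(** The total mass is [rPhi k t 0 = 1], so the constant [u0] integrates to itself and the constant 1
    in each coefficient of [primsum] to 1. *)
Lemma tame_primsum t l : 0 < t -> all (fun p => p.1 != 0) l ->
  tame (mu t) D (fun a => u0 + @primsum R c X l a)
    (u0 + \sum_(p <- l) ofR c ((rPhi k t p.1 - 1) / p.1) *: p.2).
Proof.
move=> t0 l0; have hm := hmu (ltW t0); have muD := hm.1.
apply: (tameD mD muD).
  have [i1 E1] := laplace_exp (ltW t0) hm 0.
  have := tame_scale mD muD u0 i1; rewrite E1 rPhi0// ofR1 scale1r.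
  by apply: eq_tame => a _; rewrite mul0r expR0 ofR1 scale1r.
apply: (@tame_sum _ _ _ _ _ (mu t) D mD muD _ l (fun p a => ofR c ((expR (p.1 * a) - 1) / p.1) *: p.2)) => p.
have [ip Ep] := laplace_exp (ltW t0) hm p.1.
have [i1 E1] := laplace_exp (ltW t0) hm 0.
have E0 : (fun a => expR (p.1 * a) - expR (0 * a)) = (fun a => expR (p.1 * a) - 1).
  by apply/funext => a; rewrite mul0r expR0.
have iB : (mu t).-integrable D (EFin \o (fun a => expR (p.1 * a) - 1)).
  by rewrite -E0; exact: (integrableB mD ip i1).
have iZ : (mu t).-integrable D (EFin \o (fun a => (expR (p.1 * a) - 1) / p.1)).
  exact: (integrableZr mD _ iB).
have <- : \int[mu t]_(a in D) ((expR (p.1 * a) - 1) / p.1) = (rPhi k t p.1 - 1) / p.1.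
  by rewrite RintegralZr// -E0 RintegralB// Ep E1 rPhi0.
exact: tame_scale.
Qed.

(** Let [l] approximate the orbit of [gen T u0]. By [Phi_op_gen] the integrand is [k t s] times
    [Phi_op] at [gen T u0], hence close to [k t s] times [phisum s l]; one [l] serves all [s < t],
    since [rPhi k s W] is bounded there. *)
Lemma Phi_op_solution t : 0 < t ->
  bochner_integrable leb `]0, t[ (fun s => ofR c (k t s) *: gen T (u s)) /\
  u t = u0 + bochner_integral leb `]0, t[ (fun s => ofR c (k t s) *: gen T (u s)).
Proof.
move=> t0; have hm := hmu (ltW t0); have muD := hm.1.
have [M [M1 [w TM]]] := semigroup_growth hT.
pose W : R := w%:R + 3 / 2.
have [B B0 hB] := rPhi_bound hk W t0.
have [I I0 hI] := kernel_L1_bound hk t0.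
have mI : measurable (`]0, t[%classic : set (measurableTypeR R)) by exact: measurable_itv.
have fI : (leb `]0%R, t[%classic < +oo)%E by rewrite mu_itv0 ?ltW// ltry.
have mk := kernel_section_measurable hk t0.
(* The weight for [tame_lim]: at time [s] the approximation error is at most
   [e * rPhi k s W <= e * B]. *)
pose h s := `|k t s| * B.
have mh : measurable_fun `]0, t[ h.
  by apply: measurable_funM => //; exact: measurableT_comp.
have h0 s : 0 <= h s by rewrite mulr_ge0.
have hH : (\int[leb]_(s in `]0%R, t[) (h s)%:E <= (B * I)%:E)%E.
  under eq_integral do rewrite /h mulrC EFinM.
  rewrite ge0_integralZl_EFin//; last first.
    by apply/measurable_EFinP; exact: measurableT_comp.
  by rewrite EFinM lee_wpmul2l// lee_fin.
pose f s := ofR c (k t s) *: gen T (u s).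
pose p (l : seq (R * X)) s := \sum_(q <- l) ofR c (k t s * rPhi k s q.1) *: q.2.
pose v (l : seq (R * X)) := \sum_(q <- l) ofR c (\int[leb]_(s in `]0, t[) (k t s * rPhi k s q.1)) *: q.2.
have tp l : tame leb `]0, t[ (p l) (v l).
  apply: (@tame_sum _ _ _ _ _ leb _ mI fI _ l (fun q s => ofR c (k t s * rPhi k s q.1) *: q.2)) => q.
  by apply: tame_scale => //; exact: rPhi_kernel_integrable.
have fp l e : 0 < e ->
    (forall a, 0 <= a -> rnorm (T a y - expsum l a) <= e * expR (W * a)) ->
    forall s, `]0, t[%classic s -> rnorm (f s - p l s) <= e * h s.
  move=> e0 hl s; rewrite /= in_itv/= => /andP[s0 st].
  have hs := hmu (ltW s0).
  have [_ Eg] := Phi_op_gen (ltW s0) hs u0D; rewrite /f Eg.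
  have -> : p l s = ofR c (k t s) *: phisum s l.
    rewrite /phisum scaler_sumr; apply: eq_bigr => q _.
    by rewrite ofRM scalerA.
  rewrite -scalerBr rnormZr mulrCA ler_wpM2l//.
  rewrite (le_trans (Phi_op_dist (ltW s0) hs (ltW e0) hl))// ler_wpM2l ?(ltW e0)//.
  by rewrite (le_trans (ler_norm _))// hB// ltW.
have [z tz] : exists z, tame leb `]0, t[ f z.
  apply: (@tame_lim _ _ _ _ _ leb _ mI fI f h (B * I) mh (fun s _ => h0 s) hH) => e e0.
  have [l [_ hl]] := semigroup_expsum hT M1 TM y e0.
  by exists (p l), (v l); split=> //; exact: fp hl.
split; first exact: (tame_integrable mI fI tz).
rewrite (tame_integral mI fI tz).
apply: rnorm_eq => e e0.
(* The mean value inequality turns the error [e^(W a)] into [a e^(W a)], which is at most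
   [e^((W + 1) a)]. *)
pose r := rPhi k t (W + 1); have r0 : 0 <= r by exact: (rPhi_ge0 (ltW t0) hm).
have K0 : 0 < r + B * I + 1 by rewrite ltr_wpDl// addr_ge0// mulr_ge0.
pose dl := e / (r + B * I + 1); have dl0 : 0 < dl by rewrite divr_gt0.
have [l [l0 hl]] := semigroup_expsum hT M1 TM y dl0.
have d1 : rnorm (z - v l) <= dl * (B * I).
  apply: (tame_dist mI fI tz (tp l) (e := fun s => dl * h s)).
  - exact: measurable_funM.
  - exact: fp hl.
  - under eq_integral do rewrite EFinM.
    rewrite ge0_integralZl_EFin ?(ltW dl0)//; last 2 first.
    + by move=> s _; rewrite lee_fin.
    + exact/measurable_EFinP.
    by rewrite (EFinM dl) lee_wpmul2l// lee_fin ltW.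
(* Here the two sides of the equation meet, term by term through the scalar Volterra equation
   divided by the nonzero exponent. *)
have vE : \sum_(q <- l) ofR c ((rPhi k t q.1 - 1) / q.1) *: q.2 = v l.
  rewrite /v big_seq [RHS]big_seq; apply: eq_bigr => q ql.
  have q0 : q.1 != 0 by move/allP : l0; exact.
  by rewrite -(rPhi_volterra hk _ t0) mulrAC mulfV// mul1r.
have d2 : rnorm (u t - (u0 + v l)) <= dl * r.
  rewrite -vE; apply: (tame_dist mD muD (tame_Phi_op (ltW t0) hm u0) (tame_primsum t0 l0)
    (scaled_exp_measurable dl (W + 1))); last first.
    by apply: (scaled_exp_integral_le (ltW t0) hm); exact: ltW.
  move=> a; rewrite /= in_itv/= andbT => a0.
  rewrite opprD addrA.
  apply: (le_trans (semigroup_mean_value hT u0D l0 _ hl a0)).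
    move=> a1 a2; rewrite !inE => a10 a20 a12.
    rewrite ler_pM2l// ler_expR ler_wpM2l// addr_ge0//.
  rewrite mulrCA ler_pM2l// (mulrDl W 1) mul1r expRD mulrC ler_wpM2l ?expR_ge0//.
  by apply: le_trans (expR_ge1Dx a); rewrite lerDr.
have := rnormB_split (u0 + v l) (u t) (u0 + z).
have -> : rnorm (u0 + v l - (u0 + z)) = rnorm (z - v l).
  by rewrite opprD addrACA subrr add0r rnormBC.
have : dl * (r + B * I + 1) = e by rewrite /dl divfK// gt_eqF.
lra.
Qed.

Lemma Phi_op_cvg0 : u t @[t --> 0^'+] --> u0.
Proof.
apply/cvg_rnormP => e e0; apply/near_at_right0.
have [M [M1 [w TM]]] := semigroup_growth hT.
pose C := M * rnorm y.
have C0 : 0 <= C by rewrite mulr_ge0 ?rnorm_ge0// (le_trans _ M1).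
have d0 : 0 < e / (2 * C + 1) by rewrite divr_gt0// ltr_wpDl// mulr_ge0.
have [h1 h10 H1] := rPhi_small hk w%:R d0.
have [h2 h20 H2] := rPhi_small hk (w%:R + 1) d0.
exists (Num.min h1 h2) => [|t t0]; first by rewrite lt_min h10.
rewrite lt_min => /andP[/ltW th1 /ltW th2].
have hm := hmu (ltW t0); have muD := hm.1.
have [iw Ew] := laplace_exp (ltW t0) hm w%:R.
have [iw1 Ew1] := laplace_exp (ltW t0) hm (w%:R + 1).
(* The mean value inequality with the empty sum gives the error [C a e^(w a)], and [a <= e^a - 1]
   bounds it by [g a]. The difference matters: its integral tends to 0 with [t], since both values
   of [rPhi] tend to 1. *)
pose g (a : R) := C * (expR ((w%:R + 1) * a) - expR (w%:R * a)).
have ig : (mu t).-integrable D (EFin \o g).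
  by apply: (integrableZl mD _ (integrableB mD iw1 iw)).
have Eg : \int[mu t]_(a in D) g a = C * (rPhi k t (w%:R + 1) - rPhi k t w%:R).
  by rewrite RintegralZl//; [rewrite RintegralB// Ew Ew1|exact: (integrableB mD iw1 iw)].
have tc := tame_primsum t0 (isT : all (fun p : R * X => p.1 != 0) [::]).
rewrite big_nil addr0 in tc.
have : rnorm (u t - u0) <= C * (rPhi k t (w%:R + 1) - rPhi k t w%:R).
  apply: (tame_dist mD muD (tame_Phi_op (ltW t0) hm u0) tc (e := g)).
  - by case/integrableP: ig => /measurable_EFinP.
  - move=> a; rewrite /= in_itv/= andbT => a0.
    have := @semigroup_mean_value _ _ _ _ hT u0 [::] (fun a => C * expR (w%:R * a)) u0D isT.
    move=> /(_ _ _ a a0)/le_trans; rewrite opprD addrA; apply => //.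
    + move=> a1 a2 _ _ a12; rewrite ler_wpM2l// ler_expR ler_wpM2l//.
    + by move=> b b0; rewrite /expsum big_nil subr0 mulrAC TM.
    + rewrite mulrCA ler_wpM2l// mulrDl mul1r expRD.
      have := expR_ge1Dx a; have := expR_gt0 (w%:R * a); nra.
  - rewrite -Eg /Rintegral fineK//; exact: integrable_fin_num.
rewrite rnormBC => /le_lt_trans; apply.
have := H1 t t0 th1; have := H2 t t0 th2.
move: (rPhi k t (w%:R + 1)) (rPhi k t w%:R) => r1 r2.
rewrite !ler_norml => /andP[_ h] /andP[h' _].
have E : e / (2 * C + 1) * (2 * C + 1) = e by rewrite divfK// gt_eqF// ltr_wpDl// mulr_ge0.
move: E d0 h h'; set d := e / _; nra.
Qed.

End evolution.

End subordination.

(** * Laplace transforms of the laws of random variables *)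

Section laplace_transform.
Context (R : realType).

Local Notation D := (`[0, +oo[%classic : set R).

Lemma Re_cexp_scale (l : R[i]) (a : R) : complex.Re (cexp (- l * (a%:C)%C)) =
  expR (- (complex.Re l * a)) * cos (- (complex.Im l * a)).
Proof.
by case: l => x y /=; rewrite !mulr0 subr0 add0r !mulNr.
Qed.

Lemma Im_cexp_scale (l : R[i]) (a : R) : complex.Im (cexp (- l * (a%:C)%C)) =
  expR (- (complex.Re l * a)) * sin (- (complex.Im l * a)).
Proof.
by case: l => x y /=; rewrite !mulr0 subr0 add0r !mulNr.
Qed.

(** As [Y] is nonnegative, the preimage of [D] is the whole space, and the bound on [g] over [D]
    supplies the integrability that the change of variables requires. *)
Lemma Rintegral_distribution d (Om : measurableType d) (P : probability Om R)
    (Y : {RV P >-> R}) (g : R -> R) :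
  (forall w, 0 <= Y w) -> measurable_fun setT g ->
  (forall a, 0 <= a -> `|g a| <= 1) ->
  \int[distribution P Y]_(a in D) g a = \int[P]_(w in setT) g (Y w).
Proof.
move=> Y0 mg g1; rewrite /Rintegral; congr fine.
have YD : Y @^-1` D = setT.
  by apply/seteqP; split => // w _; rewrite /= in_itv/= andbT.
rewrite /distribution integral_pushforward//.
- by rewrite YD.
- exact/measurable_EFinP.
- rewrite YD; apply: measurable_bounded_integrable => //.
  + by rewrite -ge0_fin_numE// fin_num_measure.
  + exact: measurableT_comp.
  + exists 1; split => // M M1 w _ /=.
    by rewrite (le_trans (g1 _ (Y0 w)))// ltW.
Qed.

Lemma cexp_parts_bound (l : R[i]) : 0 <= complex.Re l -> forall a, 0 <= a ->
  `|complex.Re (cexp (- l * (a%:C)%C))| <= 1 /\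
  `|complex.Im (cexp (- l * (a%:C)%C))| <= 1.
Proof.
move=> l0 a a0; rewrite Re_cexp_scale Im_cexp_scale !normrM.
have E0 : 0 <= `|expR (- (complex.Re l * a))| by [].
have E1 : `|expR (- (complex.Re l * a))| <= 1.
  by rewrite ger0_norm ?expR_ge0// -expR0 ler_expR oppr_le0 mulr_ge0.
split; rewrite -[leRHS]mulr1 ler_pM//.
  by rewrite ler_norml cos_geN1 cos_le1.
by rewrite ler_norml sin_geN1 sin_le1.
Qed.

Lemma cexp_parts_measurable (l : R[i]) :
  measurable_fun setT (fun a : R => complex.Re (cexp (- l * (a%:C)%C))) /\
  measurable_fun setT (fun a : R => complex.Im (cexp (- l * (a%:C)%C))).
Proof.
have mE : measurable_fun setT (fun a : R => expR (- (complex.Re l * a))).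
  by apply: measurableT_comp => //; exact: measurableT_comp.
split.
  under eq_fun do rewrite Re_cexp_scale.
  apply: measurable_funM => //; apply: measurableT_comp.
    by apply: continuous_measurable_fun => x; exact: continuous_cos.
  exact: measurableT_comp.
under eq_fun do rewrite Im_cexp_scale.
apply: measurable_funM => //; apply: measurableT_comp.
  by apply: continuous_measurable_fun => x; exact: continuous_sin.
exact: measurableT_comp.
Qed.

Lemma laplace_scale d (Om : measurableType d) (P : probability Om R)
    (Y Z : {RV P >-> R}) (r : R) (l : R[i]) :
  0 <= r -> (forall w, 0 <= Y w) -> (forall w, Z w = Y w * r) -> 0 <= complex.Re l ->
  laplace (distribution P Z) l = laplace (distribution P Y) (l * (r%:C)%C).
Proof.
move=> r0 Y0 ZE l0.
have Z0 w : 0 <= Z w by rewrite ZE mulr_ge0.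
have lr0 : 0 <= complex.Re (l * (r%:C)%C).
  by case: l l0 => x y /= x0; rewrite mulr0 subr0 mulr_ge0.
have [mR mI] := cexp_parts_measurable l.
have [mRr mIr] := cexp_parts_measurable (l * (r%:C)%C).
have E w : - (l * (r%:C)%C) * ((Y w)%:C)%C = - l * ((Z w)%:C)%C.
  by rewrite ZE rmorphM/=; ring.
rewrite /laplace; congr (_ +i* _)%C.
- rewrite Rintegral_distribution//; last by move=> a /(cexp_parts_bound l0)[].
  rewrite Rintegral_distribution//; last by move=> a /(cexp_parts_bound lr0)[].
  by apply: eq_Rintegral => w _; rewrite E.
- rewrite Rintegral_distribution//; last by move=> a /(cexp_parts_bound l0)[].
  rewrite Rintegral_distribution//; last by move=> a /(cexp_parts_bound lr0)[].
  by apply: eq_Rintegral => w _; rewrite E.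
Qed.

Lemma represents_real_laplace (k : R -> R -> R) (t : R) d (Om : measurableType d)
    (P : probability Om R) (A : {RV P >-> R}) : admissible k -> 0 <= t ->
  represents k t A -> real_laplace k (distribution P A) t.
Proof.
move=> hk t0 [A0 hA]; split.
  apply: (@le_lt_trans _ _ 1%E); last exact: ltry.
  exact: probability_le1.
move=> l l0; have := congr1 (@complex.Re R) (hA (l%:C)%C l0); rewrite -rmorphN (Phi_real hk)// => E.
rewrite -[RHS]/(complex.Re ((rPhi k t (- l))%:C)%C) -{}E /laplace.
by apply: eq_Rintegral => a _; rewrite Re_cexp_scale /= mul0r oppr0 cos0 mulr1.
Qed.

End laplace_transform.

Theorem theorem2p1 (R : realType) (c : scalar_kind)
    (X : completeNormedModType (scalars R c))
    (T : R -> X -> X) (hT : strongly_continuous_semigroup T)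
    (k : R -> R -> R) (hk : admissible k)
    (d : R -> measure_display) (Omega : forall t : R, measurableType (d t))
    (P : forall t : R, probability (Omega t) R)
    (A : forall t : R, {RV (P t) >-> R})
    (hA : forall t : R, 0 <= t -> represents k t (A t)) :
  [/\
    (* (i) *)
    forall t : R, 0 <= t ->
      (forall x : X,
         bochner_integrable (distribution (P t) (A t)) `[0, +oo[
           (fun a => T a x)) /\
      bounded_linear_operator (Phi_op T (distribution (P t) (A t))),
    (* (ii) *)
    forall u0 : X, gen_dom T u0 ->
      let u := fun t : R => Phi_op T (distribution (P t) (A t)) u0 in
      [/\ forall s : R, 0 <= s -> gen_dom T (u s),
          forall t : R, 0 < t ->
            bochner_integrable (@lebesgue_measure R) `]0, t[
              (fun s => ofR c (k t s) *: gen T (u s)) /\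
            u t = u0 + bochner_integral (@lebesgue_measure R) `]0, t[
              (fun s => ofR c (k t s) *: gen T (u s)) &
          u t @[t --> 0^'+] --> u0] &
    (* (iii) *)
    forall theta : R, 0 < theta -> homogeneous k (theta - 1) ->
      (exists (d' : measure_display) (Omega' : measurableType d')
         (P' : probability Omega' R) (A' : {RV P' >-> R}),
         represents k 1 A') /\
      forall (d' : measure_display) (Omega' : measurableType d')
        (P' : probability Omega' R) (A' : {RV P' >-> R}),
        represents k 1 A' ->
        forall t : R, 0 <= t ->
          represents k t (t `^ theta \o* A' : {RV P' >-> R}) /\
          forall x : X,
            bochner_integrable
              (distribution P' (t `^ theta \o* A' : {mfun Omega' >-> R})) `[0, +oo[
              (fun a => T a x) /\
            Phi_op T (distribution P' (t `^ theta \o* A' : {mfun Omega' >-> R})) x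
            = Phi_op T (distribution (P t) (A t)) x
  ].
Proof.
have hmu t (t0 : 0 <= t) := represents_real_laplace hk t0 (hA t t0).
have mD : measurable (`[0, +oo[%classic : set R) by exact: measurable_itv.
split.
- move=> t t0; split => [x|].
    exact: (tame_integrable mD (hmu t t0).1 (tame_Phi_op hT hk t0 (hmu t t0) x)).
  split; first exact: (Phi_op_linear hT hk t0 (hmu t t0)).
  by have [K _ hK] := Phi_op_bound hT hk t0 (hmu t t0); exists K.
- move=> u0 u0D u; split.
  + by move=> s s0; have [] := Phi_op_gen hT hk s0 (hmu s s0) u0D.
  + move=> t t0; exact: (Phi_op_solution hT hk hmu u0D t0).
  + exact: (Phi_op_cvg0 hT hk hmu u0D).
- move=> theta theta0 hom; split.
    by exists (d 1), (Omega 1), (P 1), (A 1); exact: hA.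
  move=> d' Omega' P' A' hA' t t0.
  (* Scaling the variable scales the argument of its transform by [t^theta], which homogeneity
     converts into passing from time 1 to time [t]. *)
  have hr : represents k t (t `^ theta \o* A' : {RV P' >-> R}).
    have [A0 hL] := hA'; split=> [w|l l0].
      by rewrite /= mulr_ge0// powR_ge0.
    rewrite (laplace_scale (Y := A') (r := t `^ theta)) ?powR_ge0//.
    rewrite hL; last first.
      by case: l l0 => x y /= x0; rewrite mulr0 subr0 mulr_ge0// powR_ge0.
    by rewrite [RHS](Phi_homogeneous hk theta0 hom)// mulNr.
  split=> // x; have hnu := represents_real_laplace hk t0 hr; split.
    exact: (tame_integrable mD hnu.1 (tame_Phi_op hT hk t0 hnu x)).
  exact: (Phi_op_unique hT hk x t0 hnu (hmu t t0)).
Qed.
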